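(* Let $P$ be an orthogonal projection in a $W^\star$-non commutative probability space $(\mathscr{A},\tau)$ with $\tau(P)=\theta\in(0,1)$, let $S=2P-{\bf 1}$ and $\epsilon=[\tau(S)]^2$, and let $Y=(Y_t)_{t\ge0}\subset\mathscr{A}$ be a free unitary Brownian motion $\star$-free from $P$. For $n\ge1$ put $s_n(t)=e^{nt}\tau[(SY_tSY_t^\star)^n]$; it has the form $s_n(t)=P_n(\epsilon,t)+\sum_{k=1}^{n}e^{kt}Q_{n,k}(t)$ with $P_n(\epsilon,\cdot)$ and $Q_{n,k}$ polynomials in $t$. Then for every $n\ge1$ $$P_n(\epsilon,0)=\sum_{\pi\in \mathrm{NC}(2n)}\frac1{2^{|\pi|}}\,c_\pi(a_1-a_2,a_1-a_2,\dots,a_1-a_2),$$ where $a_1,a_2$ are two free copies of $S$; that is, $P_n(\epsilon,0)$ is the $n$-th even moment (the moment of order $2n$) of the $1/2$-fold free convolution of the spectral distribution of $a_1-a_2$.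
   Context: A $W^\star$-non commutative probability space $(\mathscr{A},\tau)$ is a von Neumann algebra $\mathscr{A}$ with unit ${\bf 1}$ endowed with a faithful (normal) tracial state $\tau$. A free unitary Brownian motion $Y=(Y_t)_{t\ge0}$ is a family of unitaries in $\mathscr{A}$ with $Y_0={\bf 1}$, with stationary $\star$-free multiplicative increments (i.e. for $0\le t_1<\dots<t_n$ the elements $Y_{t_1},Y_{t_2}Y_{t_1}^\star,\dots,Y_{t_n}Y_{t_{n-1}}^\star$ are $\star$-free and $Y_tY_s^\star$ has the law of $Y_{t-s}$ for $s<t$), and with moments $\tau(Y_t^k)=\tau((Y_t^\star)^k)=e^{-kt/2}\frac1k L^{(1)}_{k-1}(kt)$, $k\ge1$, where $L^{(1)}_{n}$ is the $n$-th Laguerre polynomial of parameter $1$. The polynomial $P_n(\epsilon,t)$ is the part of $s_n(t)$ without exponential factor. $\mathrm{NC}(2n)$ is the set of non crossing partitions of $\{1,\dots,2n\}$, $|\pi|$ is the number of blocks of $\pi$, and $c_\pi(a,\dots,a)=\prod_{V\in\pi}c_{|V|}(a,\dots,a)$ is the product over blocks $V$ of $\pi$ of free cumulants with respect to $\tau$. ''Two free copies of $S$'' means free self-adjoint elements each having the distribution $\theta\delta_1+(1-\theta)\delta_{-1}$ of $S$. The $1/2$-fold free convolution of the distribution of $a$ is understood as the moment functional whose free cumulants are one half of those of $a$ (it need not be given by a probability measure). *)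

(* Defs.v *)
From HB Require Import structures.
From mathcomp Require Import all_boot all_order all_algebra.

Set Implicit Arguments.
Unset Strict Implicit.
Unset Printing Implicit Defensive.
Import Order.TTheory GRing.Theory Num.Theory.
Local Open Scope ring_scope.

Definition noncrossing (n : nat) (pi : {set {set 'I_n}}) : bool :=
  [forall V in pi, forall W in pi,
    [exists a in V, exists b in W, exists c in V, exists d in W,
       [&& (a < b)%N, (b < c)%N & (c < d)%N]] ==> (V == W)].

Definition NC (n : nat) : {set {set {set 'I_n}}} :=
  [set pi | partition pi [set: 'I_n] && noncrossing pi].

Section FreeCumulants.
Variable K : comNzRingType.
Implicit Types (m c : nat -> K).

(* The moment-cumulant formula m_n = \sum_(pi in NC(n)) \prod_(V in pi) c_|V|
   solved recursively for the term c_n of the one-block partition;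
   cumulant_seq m n lists c_0, ..., c_n, where c_0 = 0 is a dummy value. *)
Fixpoint cumulant_seq m (n : nat) : seq K :=
  if n is k.+1 then
    let s := cumulant_seq m k in
    rcons s (m n - \sum_(pi in NC n | pi != [set [set: 'I_n]])
                     \prod_(V in pi) s`_#|V|)
  else [:: 0].

Definition free_cumulant m (n : nat) : K := (cumulant_seq m n)`_n.

Lemma size_cumulant_seq m n : size (cumulant_seq m n) = n.+1.
Proof. by elim: n => //= n IH; rewrite size_rcons IH. Qed.

Lemma nth_cumulant_seq m n k :
  (k <= n)%N -> (cumulant_seq m n)`_k = free_cumulant m k.
Proof.
elim: n => [|n IH]; first by rewrite leqn0 => /eqP->.
rewrite leq_eqVlt => /predU1P[->//|lekn].
by rewrite /= nth_rcons size_cumulant_seq lekn IH.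
Qed.

Lemma one_block_NC n : [set [set: 'I_n.+1]] \in NC n.+1.
Proof.
rewrite inE; apply/andP; split.
  apply/and3P; split; rewrite /cover ?big_set1 //.
    by apply/trivIsetP => A B /set1P-> /set1P->; rewrite eqxx.
  by apply/negP => /set1P /setP /(_ ord0); rewrite !inE.
apply/forall_inP => V /set1P->; apply/forall_inP => W /set1P->.
by apply/implyP.
Qed.

Lemma small_block n (pi : {set {set 'I_n.+1}}) (V : {set 'I_n.+1}) :
  pi \in NC n.+1 -> pi != [set [set: 'I_n.+1]] -> V \in pi -> (#|V| <= n)%N.
Proof.
rewrite inE => /andP[/and3P[covpi trpi pi0] _] npi Vpi.
rewrite leqNgt; apply: contra npi => ltnV.
have VT : V = [set: 'I_n.+1].
  by apply/eqP; rewrite eqEcard subsetT cardsT card_ord.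
apply/eqP/setP => W; rewrite inE; apply/idP/eqP => [Wpi|->]; last by rewrite -VT.
rewrite -VT; apply/eqP; apply: contraT => nWV.
have /setIidPl : W \subset V by rewrite VT subsetT.
have := trivIsetP trpi _ _ Wpi Vpi nWV; rewrite -setI_eq0 => /eqP-> W0.
by case/negP: pi0; rewrite W0.
Qed.

Lemma moment_cumulant m n : (0 < n)%N ->
  m n = \sum_(pi in NC n) \prod_(V in pi) free_cumulant m #|V|.
Proof.
case: n => // n _.
rewrite (bigD1 _ (one_block_NC n)) /= big_set1 cardsT card_ord.
rewrite {1}/free_cumulant /= nth_rcons size_cumulant_seq ltnn eqxx.
rewrite [X in _ - X + _](_ : _ =
  \sum_(pi in NC n.+1 | pi != [set setT]) \prod_(V in pi) free_cumulant m #|V|).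
  by rewrite subrK.
apply: eq_bigr => pi /andP[piNC npi]; apply: eq_bigr => V Vpi.
by rewrite nth_cumulant_seq // (small_block piNC npi).
Qed.

Lemma free_cumulant_unique m c :
  (forall n, (0 < n)%N -> m n = \sum_(pi in NC n) \prod_(V in pi) c #|V|) ->
  forall n, (0 < n)%N -> free_cumulant m n = c n.
Proof.
move=> mc; elim/ltn_ind => -[//|n] IH _.
have := mc n.+1 isT; rewrite (@moment_cumulant m) //.
rewrite !(bigD1 _ (one_block_NC n)) /= !big_set1 cardsT card_ord.
suff -> : \sum_(pi in NC n.+1 | pi != [set setT])
            \prod_(V in pi) free_cumulant m #|V| =
          \sum_(pi in NC n.+1 | pi != [set setT]) \prod_(V in pi) c #|V|.
  exact: addIr.
apply: eq_bigr => pi /andP[piNC npi]; apply: eq_bigr => V Vpi.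
apply: IH; first by rewrite ltnS (small_block piNC npi).
rewrite card_gt0; apply: contraTneq Vpi => ->.
by move: piNC; rewrite inE => /andP[/and3P[]].
Qed.

End FreeCumulants.

(* L_n^(a)(x) = \sum_(j <= n) (-1)^j C(n + a, n - j) x^j / j!. *)
Definition laguerre (K : fieldType) (a n : nat) : {poly K} :=
  \poly_(j < n.+1) ((-1) ^+ j * 'C(n + a, n - j)%:R / j`!%:R).

From mathcomp Require Import all_classical all_reals all_analysis.
From mathcomp Require Import complex.
Import numFieldNormedType.Exports.
Local Open Scope classical_set_scope.
Local Open Scope ring_scope.
Local Open Scope complex_scope.

Section OperatorAlgebras.
Variable R : realType.
Local Notation C := R[i].

Definition bounded_operator (H : completeNormedModType C) : set (H -> H) :=
  [set T | linear T /\ continuous T].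

Definition commutant (H : completeNormedModType C) (M : set (H -> H)) :
    set (H -> H) :=
  [set T | bounded_operator T /\ forall S, M S -> T \o S = S \o T].

(* The unital algebra A, with involution star, is identified with its image
   under a faithful representation rep on a Hilbert space H (a complete normed
   space whose norm comes from the inner product ip, which is linear in its
   first argument); this image is its own bicommutant. That star is a
   conjugate-linear involution reversing products follows from the adjunction
   clause and faithfulness. *)
Definition von_neumann_algebra (A : algType C) (star : A -> A) : Prop :=
  exists (H : completeNormedModType C) (ip : {dot H for Num.conj})
         (rep : A -> H -> H),
    [/\ (forall u, `|u| ^+ 2 = ip u u),
        injective rep /\ range rep `<=` @bounded_operator H,
        [/\ forall c x y u, rep (c *: x + y) u = c *: rep x u + rep y u,
            forall x y u, rep (x * y) u = rep x (rep y u) &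
            forall u, rep 1 u = u],
        (forall x u v, ip (rep x u) v = ip u (rep (star x) v)) &
        commutant (commutant (range rep)) = range rep].

Definition self_adjoint (A : algType C) (star : A -> A) (x : A) : Prop :=
  star x = x.

Definition op_le (A : algType C) (star : A -> A) (x y : A) : Prop :=
  exists z, y - x = star z * z.

(* tau preserves suprema of upward directed sets of self-adjoint elements;
   the values of a state on self-adjoint elements are real. *)
Definition normal_functional (A : algType C) (star : A -> A) (tau : A -> C) :
    Prop :=
  forall (D : set A) (s : A),
    D !=set0 ->
    D `<=` self_adjoint star ->
    (forall x y, D x -> D y ->
       exists z, [/\ D z, op_le star x z & op_le star y z]) ->
    self_adjoint star s ->
    (forall x, D x -> op_le star x s) ->
    (forall u, self_adjoint star u ->
       (forall x, D x -> op_le star x u) -> op_le star s u) ->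
    forall c : R, (forall x, D x -> tau x <= c%:C) -> tau s <= c%:C.

Definition tracial_state (A : algType C) (star : A -> A) (tau : A -> C) : Prop :=
  [/\ tau 1 = 1,
      forall x, 0 <= tau (star x * x) &
      forall x y, tau (x * y) = tau (y * x)].

Definition faithful (A : algType C) (star : A -> A) (tau : A -> C) : Prop :=
  forall x, tau (star x * x) = 0 -> x = 0.

End OperatorAlgebras.

Record wstar_probability_space (R : realType) := WstarProbabilitySpace {
  carrier :> algType R[i];
  star : carrier -> carrier;
  trace : {scalar carrier};
  _ : von_neumann_algebra star;
  _ : tracial_state star trace;
  _ : faithful star trace;
  _ : normal_functional star trace
}.

Section FreeProbability.
Variable R : realType.
Implicit Types A B : wstar_probability_space R.

Definition unitary A (u : A) : Prop := star u * u = 1 /\ u * star u = 1.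

Definition orthogonal_projection A (p : A) : Prop :=
  self_adjoint (@star R A) p /\ p * p = p.

Definition star_subalgebra A (M : set A) : Prop :=
  [/\ M 1,
      forall c x y, M x -> M y -> M (c *: x + y),
      forall x y, M x -> M y -> M (x * y) &
      forall x, M x -> M (star x)].

Definition star_algebra A (G : set A) : set A :=
  smallest (@star_subalgebra A) G.

Definition star_free A (I : Type) (G : I -> set A) : Prop :=
  forall (n : nat) (i : nat -> I) (x : nat -> A),
    (forall k, (k <= n)%N -> star_algebra (G (i k)) (x k) /\ trace A (x k) = 0) ->
    (forall k, (k < n)%N -> i k <> i k.+1) ->
    trace A (\prod_(0 <= k < n.+1) x k) = 0.

Definition star_free2 A (G1 G2 : set A) : Prop :=
  star_free (fun b : bool => if b then G1 else G2).

(* The word w stands for the *-monomial with letters x (false), x^* (true). *)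
Definition star_monomial A (x : A) (w : seq bool) : A :=
  \prod_(b <- w) (if b then star x else x).

Definition same_star_distribution A B (x : A) (y : B) : Prop :=
  forall w, trace A (star_monomial x w) = trace B (star_monomial y w).

(* Y_{t_1}, Y_{t_2} Y_{t_1}^*, ..., with the times indexed from 0. *)
Definition mul_increment A (Y : R -> A) (t : nat -> R) (k : nat) : A :=
  if k is j.+1 then Y (t k) * star (Y (t j)) else Y (t 0).

(* Only the values Y t with 0 <= t are meaningful. *)
Record free_unitary_brownian_motion A (Y : R -> A) : Prop := {
  fubm_unitary : forall t, 0 <= t -> unitary (Y t);
  fubm0 : Y 0 = 1;
  fubm_free : forall (n : nat) (t : nat -> R),
    0 <= t 0 ->
    (forall k, (k.+1 < n)%N -> t k < t k.+1) ->
    star_free (fun k : 'I_n => [set mul_increment Y t k]);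
  fubm_stationary : forall s t, 0 <= s -> s < t ->
    same_star_distribution (Y t * star (Y s)) (Y (t - s));
  fubm_moments : forall t (k : nat), 0 <= t -> (0 < k)%N ->
    let m := (expR (- (k%:R * t / 2)) * k%:R^-1
              * (laguerre R 1 k.-1).[k%:R * t])%:C in
    trace A (Y t ^+ k) = m /\ trace A (star (Y t) ^+ k) = m
}.

(* The free cumulant c_n(a, ..., a). *)
Definition cumulant A (a : A) (n : nat) : R[i] :=
  free_cumulant (fun j => trace A (a ^+ j)) n.

(* mu is the r-fold free convolution of the distribution of a, as a linear
   functional on polynomials. *)
Definition free_convolution_power A (r : R) (a : A) (mu : {scalar {poly R[i]}}) :
    Prop :=
  mu 1 = 1 /\
  forall n, (0 < n)%N ->
    free_cumulant (fun j => mu 'X^j) n = r%:C * cumulant a n.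

(* s t = P(t) + \sum_(1 <= k <= n) e^{kt} Q_k(t) for all t >= 0. *)
Definition exp_poly_form (n : nat) (s : R -> R[i]) (P : {poly R})
    (Q : nat -> {poly R}) : Prop :=
  forall t, 0 <= t ->
    s t = (P.[t] + \sum_(1 <= k < n.+1) expR (k%:R * t) * (Q k).[t])%:C.

End FreeProbability.

Lemma free_convolution_power_exists (R : realType)
    (A : wstar_probability_space R) (r : R) (a : A) :
  exists mu, free_convolution_power r a mu.
Proof.
pose c n : R[i] := r%:C * cumulant a n.
pose m n : R[i] :=
  if n is 0 then 1 else \sum_(pi in NC n) \prod_(V in pi) c #|V|.
pose f (p : {poly R[i]}) : R[i] := \sum_(i < size p) p`_i * m i.
have fE (N : nat) (p : {poly R[i]}) : (size p <= N)%N -> f p = \sum_(i < N) p`_i * m i.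
  move=> leN; rewrite /f (big_ord_widen _ (fun i => p`_i * m i) leN) big_mkcond.
  apply: eq_bigr => i _; case: ltnP => // lei.
  by rewrite nth_default // mul0r.
have f_lin : linear_for *%R f.
  move=> b p q; pose N := maxn (size (b *: p + q)) (maxn (size p) (size q)).
  rewrite !(fE N) ?leq_max ?leqnn ?orbT // mulr_sumr -big_split /=.
  by apply: eq_bigr => i _; rewrite coefD coefZ mulrDl mulrA.
pose mu : {scalar {poly R[i]}} :=
  HB.pack f (GRing.isLinear.Build R[i] {poly R[i]} R[i] *%R f f_lin).
have muX n : mu 'X^n = m n.
  rewrite /mu /= /f size_polyXn big_ord_recr /= coefXn eqxx mul1r big1 ?add0r //.
  by move=> i _; rewrite coefXn ltn_eqF ?mul0r.
exists mu; split; first by rewrite -[1]/('X^0 : {poly R[i]}) muX.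
apply: free_cumulant_unique => -[//|n] _.
by rewrite muX.
Qed.

(* Main.v *)
(* Freeness of S and Y gives the first-block expansion
     tau(S n_1 S n_2 ... S n_m) = sum_k c_k(S) sum over gaps of the product of
   the traces of the gaps,
   where the gaps are the words between the letters S that form the block of the
   first one. A gap is again a word in S and Y, so by induction on the number of
   letters S every e^{dt/2} tau(Y^{l_1} S Y^{l_2} ... S Y^{l_r}), with d the sum of
   the |l_i|, is a polynomial in t and e^t. If the signs of the l_i alternate, the
   polynomial of a gap whose end exponents have opposite signs is divisible by e^t,
   since these exponents merge under the trace; so at e^t = 0, t = 0 only the even
   blocks survive and the recursion becomes that of the moments whose free
   cumulants are c_{2k}(S) in even order and 0 in odd order. These are half the
   free cumulants of a_1 - a_2. *)
Require Import Defs.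
From HB Require Import structures.
From mathcomp Require Import all_boot all_order all_algebra.
From mathcomp Require Import ring zify.

Set Implicit Arguments.
Unset Strict Implicit.
Unset Printing Implicit Defensive.
Import Order.TTheory GRing.Theory Num.Theory.
Local Open Scope ring_scope.

(** * Recursion over noncrossing partitions *)
Section NoncrossingPartitions.
Variable N : nat.
Implicit Types (D V W : {set 'I_N}) (pi rho sigma : {set {set 'I_N}}).

(** [P_n] must be exhibited from [n] and [eps] alone, before the space and the projection, while
    [eps] gives [tau(S)] only up to sign. The polynomials are therefore built for a symmetry of
    trace [Num.sqrt eps], uniformly over all models of the computation; passing from [S] to [-S]
    leaves [S Y_t S Y_t^*] unchanged and changes the sign of the odd cumulants only. Freeness is
    given as the vanishing of the trace on centered alternating products. The expansion is thus
    verified on a spanning family, where the word is a power of [S] or both sides vanish, and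
    extended by linearity. The parity works out because a gap with alternating exponents has end
    exponents of opposite signs exactly when it contains an odd number of letters [S]. The total
    number of letters is even, so an odd block leaves some odd gap, whose contribution is zero.
    Since [e^t] never vanishes, it is replaced by a formal variable; that [P_n] is well defined then
    rests on the independence of the functions [e^{kt}] over the polynomials in [t]. *)

Definition NC_on D : {set {set {set 'I_N}}} :=
  [set pi | partition pi D && noncrossing pi].

Definition ord_interval (a b : nat) : {set 'I_N} := [set i : 'I_N | (a <= i < b)%N].

Record NC_spec D pi : Prop := NCSpec {
  NC_neq0 : forall V, V \in pi -> V != set0;
  NC_sub : forall V x, V \in pi -> x \in V -> x \in D;
  NC_cover : forall x, x \in D -> exists2 V, V \in pi & x \in V;
  NC_triv : forall V W x, V \in pi -> W \in pi -> x \in V -> x \in W -> V = W;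
  NC_cross : forall V W (a b c d : 'I_N), V \in pi -> W \in pi ->
    a \in V -> b \in W -> c \in V -> d \in W ->
    (a < b)%N -> (b < c)%N -> (c < d)%N -> V = W }.

Lemma NC_onP D pi : reflect (NC_spec D pi) (pi \in NC_on D).
Proof.
rewrite inE; apply: (iffP andP) => [[/and3P[/eqP cov tri n0] nc]|H].
  split=> [V Vpi|V x Vpi xV|x xD|V W x Vpi Wpi xV xW|V W a b c d Vpi Wpi aV bW cV dW ab bc cd].
  - by apply: contraNneq n0 => <-.
  - by rewrite -cov; apply/bigcupP; exists V.
  - by move: xD; rewrite -cov => /bigcupP.
  - by rewrite -(def_pblock tri Vpi xV) (def_pblock tri Wpi xW).
  - move/forall_inP: nc => /(_ V Vpi) /forall_inP /(_ W Wpi) /implyP nc.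
    apply/eqP/nc; apply/exists_inP; exists a => //; apply/exists_inP; exists b => //.
    apply/exists_inP; exists c => //; apply/exists_inP; exists d => //.
    by rewrite ab bc cd.
split; first apply/and3P; first split.
- apply/eqP/setP => x; apply/bigcupP/idP => [[V Vpi xV]|/(NC_cover H)[V Vpi xV]].
    exact: (NC_sub H Vpi xV).
  by exists V.
- apply/trivIsetP => V W Vpi Wpi; apply: contraNT => /pred0Pn[x /andP[/= xV xW]].
  by apply/eqP; apply: (NC_triv H Vpi Wpi xV xW).
- by apply/negP => /(NC_neq0 H); rewrite eqxx.
- apply/forall_inP => V Vpi; apply/forall_inP => W Wpi; apply/implyP.
  case/exists_inP=> a aV /exists_inP[b bW] /exists_inP[c cV] /exists_inP[d dW].
  by case/and3P=> ab bc cd; apply/eqP; apply: (NC_cross H) aV bW cV dW ab bc cd.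
Qed.

Lemma NC_on0 : NC_on set0 = [set set0].
Proof.
apply/setP => pi; rewrite [RHS]inE [LHS]inE partition_set0.
apply: andb_idr => /eqP->; apply/forall_inP => V; by rewrite inE.
Qed.

Lemma mem_ord_interval a b (i : 'I_N) : (i \in ord_interval a b) = (a <= i < b)%N.
Proof. by rewrite inE. Qed.

(** * Removing the first point of a partitioned interval *)

Section Decomposition.
Variables (x : 'I_N) (b : nat).
Definition join_singleton rho := [set x] |: rho.

Lemma join_singleton_NC rho : (x < b)%N ->
  rho \in NC_on (ord_interval x.+1 b) -> join_singleton rho \in NC_on (ord_interval x b).
Proof.
move=> ltxb /NC_onP H; have xn V : V \in rho -> x \notin V.
  by move=> Vr; apply/negP => /(NC_sub H Vr); rewrite mem_ord_interval ltnn.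
have sub V y : V \in rho -> y \in V -> (x < y < b)%N.
  by move=> Vr /(NC_sub H Vr); rewrite mem_ord_interval.
apply/NC_onP; split=> [V|V y|y|V W y|V W p q r s].
- rewrite !inE => /predU1P[->|/(NC_neq0 H)//].
  by apply/set0Pn; exists x; rewrite inE.
- rewrite mem_ord_interval => /setU1P[-> /set1P->|Vr yV]; first by rewrite leqnn.
  by have /andP[/ltnW-> ->] := sub _ _ Vr yV.
- rewrite mem_ord_interval leq_eqVlt andb_orl => /orP[/andP[/eqP xy _]|xyb].
    by exists [set x]; rewrite ?setU11 // inE -val_eqE /= xy.
  have [|V Vr yV] := NC_cover H (x := y); first by rewrite mem_ord_interval.
  by exists V => //; rewrite inE Vr orbT.
- rewrite !in_setU1 => /predU1P[->|Vr] /predU1P[->|Wr] //.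
  + by move=> /set1P-> xW; have := xn _ Wr; rewrite xW.
  + by move=> xV /set1P yx; have := xn _ Vr; rewrite -yx xV.
  + exact: (NC_triv H Vr Wr).
- rewrite !in_setU1 => /predU1P[->|Vr] /predU1P[->|Wr] //.
  + by move=> /set1P-> _ /set1P-> _ xq /(ltn_trans xq); rewrite ltnn.
  + move=> _ /set1P-> _ /set1P-> _ xr /(ltn_trans xr); by rewrite ltnn.
  + exact: (NC_cross H Vr Wr).
Qed.

Lemma NC_remove_singleton pi :
  pi \in NC_on (ord_interval x b) -> [set x] \in pi ->
  pi :\ [set x] \in NC_on (ord_interval x.+1 b).
Proof.
move=> /NC_onP H xpi; apply/NC_onP; split=> [V|V y|y|V W y|V W p q r s].
- by rewrite in_setD1 => /andP[_]; apply: (NC_neq0 H).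
- rewrite in_setD1 => /andP[Vx Vpi] yV; have := NC_sub H Vpi yV.
  rewrite !mem_ord_interval => /andP[xy ->]; rewrite andbT ltn_neqAle xy andbT.
  apply: contra Vx => /eqP xy'; apply/eqP; apply: (NC_triv H Vpi xpi yV).
  by rewrite inE -val_eqE /= xy'.
- rewrite mem_ord_interval => /andP[xy yb].
  have [|V Vpi yV] := NC_cover H (x := y); first by rewrite mem_ord_interval ltnW.
  exists V => //; rewrite in_setD1 Vpi andbT; apply: contraTneq yV => ->.
  by rewrite inE -val_eqE /= gtn_eqF.
- by rewrite !in_setD1 => /andP[_ Vp] /andP[_ Wp]; apply: (NC_triv H Vp Wp).
- by rewrite !in_setD1 => /andP[_ Vp] /andP[_ Wp]; apply: (NC_cross H Vp Wp).
Qed.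

Definition next_in_block pi (i : 'I_N) : bool :=
  [exists V in pi, [&& x \in V, i \in V, (x < i)%N &
     [forall k in V, (x < k)%N ==> (i <= k)%N]]].

Lemma next_in_blockP pi i :
  reflect (exists V, [/\ V \in pi, x \in V, i \in V, (x < i)%N &
                       forall k : 'I_N, k \in V -> (x < k)%N -> (i <= k)%N])
          (next_in_block pi i).
Proof.
apply: (iffP exists_inP) => [[V Vpi /and4P[xV iV xi /forall_inP H]]|[V [Vpi xV iV xi H]]].
  by exists V; split=> // k kV; apply/implyP/H.
by exists V => //; apply/and4P; split=> //; apply/forall_inP => k /H/implyP.
Qed.

Definition add_min (i : 'I_N) V := if i \in V then x |: V else V.

(** [rs.1] partitions the points strictly between [x] and its successor [i], [rs.2] those from [i]
    on, and [x] rejoins the block of [i]. Every noncrossing partition in which [i] follows [x]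
    arises so, since no other block can reach across [i]. *)
Definition join_block (i : 'I_N) (rs : {set {set 'I_N}} * {set {set 'I_N}}) :=
  rs.1 :|: [set add_min i V | V in rs.2].

Definition split_block (i : 'I_N) pi :=
  ([set V in pi | V \subset ord_interval x.+1 i],
   [set V :\ x | V in [set V in pi | ~~ (V \subset ord_interval x.+1 i)]]).

Variable i : 'I_N.
Hypothesis ltxi : (x < i)%N.
Hypothesis ltib : (i < b)%N.

Section Join.
Variables rho sigma : {set {set 'I_N}}.
Hypothesis rhoNC : NC_spec (ord_interval x.+1 i) rho.
Hypothesis sigmaNC : NC_spec (ord_interval i b) sigma.

Let rho_lt V y : V \in rho -> y \in V -> (x < y < i)%N.
Proof. by move=> Vr /(NC_sub rhoNC Vr); rewrite mem_ord_interval. Qed.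

Let sigma_lt V y : V \in sigma -> y \in V -> (i <= y < b)%N.
Proof. by move=> Vr /(NC_sub sigmaNC Vr); rewrite mem_ord_interval. Qed.

Lemma notin_sigma V : V \in sigma -> x \notin V.
Proof. by move=> Vs; apply/negP => /(sigma_lt Vs); rewrite leqNgt ltxi. Qed.

Lemma add_minP V y : V \in sigma -> y \in add_min i V ->
  [\/ y \in V /\ (i <= y < b)%N | y = x /\ i \in V].
Proof.
move=> Vs; rewrite /add_min; case: ifP => iV; last first.
  by move=> yV; left; rewrite (sigma_lt Vs yV).
case/setU1P => [->|yV]; first by right.
by left; rewrite (sigma_lt Vs yV).
Qed.

Lemma add_minK V : V \in sigma -> add_min i V :\ x = V.
Proof.
move=> Vs; have xV := notin_sigma Vs; rewrite /add_min; case: ifP => _.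
  by rewrite setU1K.
by apply/setDidPl; rewrite disjoint_sym disjoints1.
Qed.

Lemma sub_add_min V : V \subset add_min i V.
Proof. by rewrite /add_min; case: ifP => // _; rewrite subsetU1. Qed.

Lemma join_block_NC : join_block i (rho, sigma) \in NC_on (ord_interval x b).
Proof.
have rs V W y : V \in rho -> W \in sigma -> y \in V -> y \in add_min i W -> False.
  move=> Vr Ws /(rho_lt Vr) /andP[xy yi] /(add_minP Ws)[[_]|[yx _]].
    by rewrite leqNgt yi.
  by rewrite yx ltnn in xy.
have tri V W y : V \in sigma -> W \in sigma -> y \in add_min i V ->
    y \in add_min i W -> V = W.
  move=> Vs Ws /(add_minP Vs)[[yV iyb]|[yx iV]] /(add_minP Ws)[[yW iyb']|[yx' iW]].
  - exact: (NC_triv sigmaNC Vs Ws yV yW).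
  - by move: iyb; rewrite yx' leqNgt ltxi.
  - by move: iyb'; rewrite yx leqNgt ltxi.
  - exact: (NC_triv sigmaNC Vs Ws iV iW).
apply/NC_onP; split=> [V|V y|y|V W y|V W p q r s].
- case/setUP=> [/(NC_neq0 rhoNC)//|/imsetP[W /[dup] Ws /(NC_neq0 sigmaNC)/set0Pn[y yW] ->]].
  by apply/set0Pn; exists y; apply: (subsetP (sub_add_min W)).
- rewrite mem_ord_interval.
  case/setUP=> [Vr /(rho_lt Vr)/andP[/ltnW-> yi]|/imsetP[W Ws ->]].
    exact: ltn_trans ltib.
  case/(add_minP Ws)=> [[_ /andP[iy ->]]|[-> _]]; last first.
    by rewrite leqnn (ltn_trans ltxi).
  by rewrite (leq_trans (ltnW ltxi)).
- rewrite mem_ord_interval => /andP[xy yb].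
  have [iy|yi] := leqP i y.
    have [|V Vs yV] := NC_cover sigmaNC (x := y); first by rewrite mem_ord_interval iy.
    exists (add_min i V); last exact: (subsetP (sub_add_min V)).
    by rewrite inE imset_f ?orbT.
  move: xy; rewrite leq_eqVlt => /predU1P[xy|xy].
    have [|V Vs iV] := NC_cover sigmaNC (x := i); first by rewrite mem_ord_interval leqnn.
    exists (add_min i V); first by rewrite inE imset_f ?orbT.
    have <- : x = y by apply: val_inj.
    by rewrite /add_min iV setU11.
  have [|V Vr yV] := NC_cover rhoNC (x := y); first by rewrite mem_ord_interval xy.
  by exists V => //; rewrite inE Vr.
- case/setUP=> [Vr|/imsetP[V' Vs ->]] /setUP[Wr|/imsetP[W' Ws ->]].
  + exact: (NC_triv rhoNC Vr Wr).
  + by move=> yV /(rs _ _ _ Vr Ws yV).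
  + by move=> yV /rs => /(_ _ Wr Vs yV).
  + by move=> yV yW; rewrite (tri V' W' y).
- have lt_add V0 y : V0 \in sigma -> y \in add_min i V0 -> (x < y)%N ->
      y \in V0 /\ (i <= y)%N.
    by move=> V0s /(add_minP V0s)[[yV0 /andP[iy _]]|[-> _]] //; rewrite ltnn.
  case/setUP=> [Vr|/imsetP[V' Vs ->]] /setUP[Wr|/imsetP[W' Ws ->]].
  + exact: (NC_cross rhoNC Vr Wr).
  + move=> /(rho_lt Vr)/andP[xp _] qW /(rho_lt Vr)/andP[_ ri] _ pq qr _.
    have [_ iq] := lt_add _ _ Ws qW (ltn_trans xp pq).
    by move: (leq_ltn_trans iq (ltn_trans qr ri)); rewrite ltnn.
  + move=> _ /(rho_lt Wr)/andP[xq _] rV /(rho_lt Wr)/andP[_ si] _ qr rs'.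
    have [_ ir] := lt_add _ _ Vs rV (ltn_trans xq qr).
    by move: (leq_ltn_trans ir (ltn_trans rs' si)); rewrite ltnn.
  + move=> pV qW rV sW pq qr rs'; congr (add_min _ _).
    have xp : (x <= p)%N.
      by case/(add_minP Vs): pV => [[_ /andP[ip _]]|[-> _]] //; exact: leq_trans (ltnW ltxi) ip.
    have xq := leq_ltn_trans xp pq; have xr := ltn_trans xq qr.
    have xs := ltn_trans xr rs'.
    have [qW' iq] := lt_add _ _ Ws qW xq; have [rV' ir] := lt_add _ _ Vs rV xr.
    have [sW' _] := lt_add _ _ Ws sW xs.
    case/(add_minP Vs): pV => [[pV _]|[_ iV]].
      exact: (NC_cross sigmaNC Vs Ws pV qW' rV' sW' pq qr rs').
    move: iq; rewrite leq_eqVlt => /predU1P[iq|iq].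
      have iq' : i = q by apply: val_inj.
      by apply: (NC_triv sigmaNC Vs Ws iV); rewrite iq'.
    exact: (NC_cross sigmaNC Vs Ws iV qW' rV' sW' iq qr rs').
Qed.

Lemma join_block_next : next_in_block (join_block i (rho, sigma)) i.
Proof.
have [|V Vs iV] := NC_cover sigmaNC (x := i); first by rewrite mem_ord_interval leqnn.
apply/next_in_blockP; exists (add_min i V); split=> //.
- by rewrite inE imset_f ?orbT.
- by rewrite /add_min iV setU11.
- exact: (subsetP (sub_add_min V)).
- by move=> k /(add_minP Vs)[[_ /andP[]]//|[-> _]]; rewrite ltnn.
Qed.

Lemma join_blockK : split_block i (join_block i (rho, sigma)) = (rho, sigma).
Proof.
have nsub V : V \in sigma -> ~~ (add_min i V \subset ord_interval x.+1 i).
  move=> Vs; have /set0Pn[y yV] := NC_neq0 sigmaNC Vs.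
  apply/negP => /subsetP /(_ y (subsetP (sub_add_min V) _ yV)).
  have /andP[iy _] := sigma_lt Vs yV.
  by rewrite mem_ord_interval [(y < i)%N]ltnNge iy andbF.
have sub V : V \in rho -> V \subset ord_interval x.+1 i.
  by move=> Vr; apply/subsetP => y /(rho_lt Vr); rewrite mem_ord_interval.
congr (_, _); apply/setP => V.
  rewrite !inE; apply/andP/idP => [[/orP[//|/imsetP[W Ws ->]]]|Vr].
    by rewrite (negPf (nsub _ Ws)).
  by rewrite Vr sub.
apply/imsetP/idP => [[W + ->]|Vs].
  rewrite !inE => /andP[/orP[/sub->//|/imsetP[V' V's ->] _]].
  by rewrite add_minK.
exists (add_min i V); last by rewrite add_minK.
by rewrite !inE nsub // imset_f ?orbT.
Qed.

Variable R : comNzRingType.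
Variables (c : nat -> R) (j : nat).

(** The offset counts the elements of the first block already removed on its left: taking [x] away
    moves the mark to [i] and raises [j] by one, so the argument of [c] is preserved. *)
Lemma join_block_weight :
  \prod_(V in join_block i (rho, sigma)) c (#|V| + (x \in V) * j)%N =
  (\prod_(V in rho) c #|V|) * \prod_(V in sigma) c (#|V| + (i \in V) * j.+1)%N.
Proof.
have inj : {in sigma &, injective (add_min i)}.
  by move=> V W Vs Ws e; rewrite -(add_minK Vs) e add_minK.
rewrite (eq_bigl [predU rho & [set add_min i V | V in sigma]]) => [|V]; last exact: in_setU.
rewrite bigU /=.
  rewrite (big_imset _ inj); congr (_ * _); apply: eq_bigr => V Vs.
    suff /negPf-> : x \notin V by rewrite mul0n addn0.
    by apply/negP => /(rho_lt Vs); rewrite ltnn.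
  have xV := notin_sigma Vs; rewrite /add_min; case: ifP => iV.
    by rewrite cardsU1 xV setU11 add1n !mul1n addSnnS.
  by rewrite (negPf xV).
apply/pred0P => V /=; apply/negP => /andP[Vr].
case/imsetP=> W Ws eV; have /set0Pn[y yW] := NC_neq0 sigmaNC Ws.
have /(rho_lt Vr)/andP[_] : y \in V by rewrite eV (subsetP (sub_add_min W)).
by have /andP[iy _] := sigma_lt Ws yW; rewrite ltnNge iy.
Qed.

End Join.

Section Split.
Variable pi : {set {set 'I_N}}.
Hypothesis piNC : NC_spec (ord_interval x b) pi.
Hypothesis pi_next : next_in_block pi i.

(* A block crossing i would cross the block of x, whose second element is i. *)
Lemma block_ge V y : V \in pi -> ~~ (V \subset ord_interval x.+1 i) ->
  y \in V -> y != x -> (i <= y < b)%N.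
Proof.
move=> Vpi nV yV nyx; have := NC_sub piNC Vpi yV; rewrite mem_ord_interval => /andP[xy ->].
rewrite andbT leqNgt; apply/negP => yi.
have {nyx}xy : (x < y)%N by rewrite ltn_neqAle xy andbT eq_sym -val_eqE in nyx *.
have /next_in_blockP[W [Wpi xW iW _ minW]] := pi_next.
have nVW : V <> W by move=> VW; move: yi; rewrite ltnNge minW -?VW.
have /subsetPn[z zV nz] := nV.
have := NC_sub piNC Vpi zV; rewrite mem_ord_interval leq_eqVlt => /andP[/predU1P[xz|xz] zb].
  have xz' : x = z by apply: val_inj.
  by apply: nVW; apply: (NC_triv piNC Vpi Wpi zV); rewrite -xz'.
move: nz; rewrite mem_ord_interval xz /= -leqNgt leq_eqVlt => /predU1P[iz|iz].
  have iz' : i = z by apply: val_inj.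
  by apply: nVW; apply: (NC_triv piNC Vpi Wpi zV); rewrite -iz'.
by apply: nVW; apply/esym/(NC_cross piNC Wpi Vpi xW yV iW zV).
Qed.

Lemma block_min V : V \in pi -> ~~ (V \subset ord_interval x.+1 i) ->
  (x \in V) = (i \in V).
Proof.
move=> Vpi nV; have /next_in_blockP[W [Wpi xW iW _ minW]] := pi_next.
apply/idP/idP => h.
  by rewrite (NC_triv piNC Vpi Wpi h xW).
by rewrite (NC_triv piNC Vpi Wpi h iW).
Qed.

Lemma add_min_split V : V \in pi -> ~~ (V \subset ord_interval x.+1 i) ->
  add_min i (V :\ x) = V.
Proof.
move=> Vpi nV; rewrite /add_min in_setD1 -(block_min Vpi nV).
have -> : (i != x) by rewrite -val_eqE /= gtn_eqF.
case: ifPn => /= xV; first by rewrite setD1K.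
by apply/setDidPl; rewrite disjoint_sym disjoints1.
Qed.

Lemma split_blockK : join_block i (split_block i pi) = pi.
Proof.
apply/setP => V; rewrite /join_block /= 2!inE.
apply/orP/idP => [[/andP[]//|/imsetP[W /imsetP[W']]]|Vpi].
  by rewrite inE => /andP[W'pi nW'] -> ->; rewrite add_min_split.
have [sV|nV] := boolP (V \subset ord_interval x.+1 i); [by left; rewrite Vpi | right].
apply/imsetP; exists (V :\ x); last by rewrite add_min_split.
by apply/imsetP; exists V => //; rewrite inE Vpi.
Qed.

Lemma split_block_left : (split_block i pi).1 \in NC_on (ord_interval x.+1 i).
Proof.
apply/NC_onP; split=> /= [V|V y|y|V W y|V W p q r s].
- by rewrite inE => /andP[/(NC_neq0 piNC)].
- by rewrite inE => /andP[_ /subsetP]; apply.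
- rewrite mem_ord_interval => /andP[xy yi].
  have [|V Vpi yV] := NC_cover piNC (x := y).
    by rewrite mem_ord_interval (ltnW xy) (ltn_trans yi).
  exists V => //; rewrite inE Vpi /=; apply/negPn/negP => nV.
  have := block_ge Vpi nV yV; rewrite -val_eqE /= gtn_eqF // => /(_ isT).
  by rewrite leqNgt yi.
- by rewrite !inE => /andP[Vp _] /andP[Wp _]; apply: (NC_triv piNC Vp Wp).
- by rewrite !inE => /andP[Vp _] /andP[Wp _]; apply: (NC_cross piNC Vp Wp).
Qed.

Lemma split_block_right : (split_block i pi).2 \in NC_on (ord_interval i b).
Proof.
apply/NC_onP; split=> /= [V|V y|y|V W y|V W p q r s].
(* Removing [x] cannot empty a block, because the block of [x] also contains [i]. *)
- case/imsetP=> W; rewrite inE => /andP[Wpi nW] ->; apply/set0Pn.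
  have /set0Pn[y yW] := NC_neq0 piNC Wpi; have [yx|yx] := eqVneq y x.
    exists i; rewrite in_setD1 -val_eqE /= gtn_eqF //=.
    by rewrite -(block_min Wpi nW) -yx.
  by exists y; rewrite in_setD1 yx.
- case/imsetP=> W; rewrite inE => /andP[Wpi nW] -> /setD1P[yx yW].
  by rewrite mem_ord_interval (block_ge Wpi nW).
- rewrite mem_ord_interval => /andP[iy yb].
  have [|V Vpi yV] := NC_cover piNC (x := y).
    by rewrite mem_ord_interval yb (leq_trans (ltnW ltxi)).
  exists (V :\ x).
    apply/imsetP; exists V => //; rewrite inE Vpi /=.
    by apply/subsetPn; exists y; rewrite ?mem_ord_interval // [(y < i)%N]ltnNge iy andbF.
  by rewrite in_setD1 yV andbT -val_eqE /= gtn_eqF // (leq_trans ltxi).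
- case/imsetP=> V'; rewrite inE => /andP[Vp _] -> /imsetP[W' + ->].
  rewrite inE => /andP[Wp _] /setD1P[_ yV] /setD1P[_ yW].
  by rewrite (NC_triv piNC Vp Wp yV yW).
- case/imsetP=> V'; rewrite inE => /andP[Vp _] -> /imsetP[W' + ->].
  rewrite inE => /andP[Wp _] /setD1P[_ pV] /setD1P[_ qW] /setD1P[_ rV] /setD1P[_ sW] pq qr rs.
  by rewrite (NC_cross piNC Vp Wp pV qW rV sW pq qr rs).
Qed.

End Split.
End Decomposition.
End NoncrossingPartitions.

(** * Sums over noncrossing partitions as a recursion on the first block *)

Section FirstBlockRecursion.
Variable K : comNzRingType.
Implicit Types m c : nat -> K.

(* The sum over the possible blocks containing the first of the remaining
   points: n points are left, the block has j + 1 elements so far, and p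
   points have been passed since its last element. *)
Fixpoint first_block m c (n j p : nat) : K :=
  if n is n'.+1 then
    m p * first_block m c n' j.+1 0 + first_block m c n' j p.+1
  else c j.+1 * m p.

(** The definition decides point by point; grouped by the length of the current gap it matches the
    partition side, where the next element of the block is selected at once. *)
Lemma first_block_expand m c n j p :
  first_block m c n j p = c j.+1 * m (p + n)%N +
    \sum_(i < n) m (p + i)%N * first_block m c (n - i.+1) j.+1 0.
Proof.
elim: n p => [|n IH] p /=; first by rewrite big_ord0 addr0 addn0.
rewrite big_ord_recl /= addn0 subn1 /= IH addrCA addSnnS; congr (_ + (_ + _)).
by apply: eq_bigr => i _; rewrite addSnnS subSS.
Qed.

Lemma eq_first_block m m' c c' n j p :
  (forall k, (k <= p + n)%N -> m k = m' k) ->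
  (forall k, (k <= j + n)%N -> c k.+1 = c' k.+1) ->
  first_block m c n j p = first_block m' c' n j p.
Proof.
elim: n j p => [|n IH] j p em ec /=.
  by rewrite em ?addn0 // ec ?addn0.
congr (_ * _ + _); first by rewrite em ?leq_addr.
  apply: IH => k; rewrite ?add0n ?addSnnS => kn; last exact: ec.
  by apply: em; apply: leq_trans kn _; rewrite addnS leqW ?leq_addl.
apply: IH => k; first by rewrite addSnnS; apply: em.
by move=> kn; apply: ec; rewrite addnS leqW.
Qed.

Section Sums.
Variable c : nat -> K.

Definition NC_sum N (a b : nat) : K :=
  \sum_(pi in NC_on (ord_interval N a b)) \prod_(V in pi) c #|V|.

Definition NC_sum_first N (x : 'I_N) (b j : nat) : K :=
  \sum_(pi in NC_on (ord_interval N x b)) \prod_(V in pi) c (#|V| + (x \in V) * j)%N.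

Lemma NC_sum_singleton N (x : 'I_N) b j : (x < b)%N ->
  \sum_(pi in NC_on (ord_interval N x b) | [set x] \in pi)
     \prod_(V in pi) c (#|V| + (x \in V) * j)%N = c j.+1 * NC_sum N x.+1 b.
Proof.
move=> ltxb; rewrite mulr_sumr.
have xn rho V : rho \in NC_on (ord_interval N x.+1 b) -> V \in rho -> x \notin V.
  by move=> /NC_onP H Vr; apply/negP => /(NC_sub H Vr); rewrite mem_ord_interval ltnn.
have xr rho : rho \in NC_on (ord_interval N x.+1 b) -> [set x] \notin rho.
  by move=> H; apply/negP => /(xn _ _ H); rewrite set11.
rewrite (reindex_onto (join_singleton x) (fun pi => pi :\ [set x])); last first.
  by move=> pi /andP[_ xpi]; rewrite /join_singleton setD1K.
rewrite (eq_bigl (fun rho => rho \in NC_on (ord_interval N x.+1 b))); last first.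
  move=> rho; apply/andP/idP => [[/andP[piNC xpi] /eqP<-]|rNC].
    exact: NC_remove_singleton.
  by rewrite join_singleton_NC // setU11 setU1K // xr.
apply: eq_bigr => rho rNC; rewrite big_setU1 ?xr //= cards1 set11 mul1n.
congr (_ * _); apply: eq_bigr => V Vr.
by rewrite (negPf (xn _ _ rNC Vr)) mul0n addn0.
Qed.

Lemma NC_sum_next N (x i : 'I_N) b j : (x < i)%N -> (i < b)%N ->
  \sum_(pi in NC_on (ord_interval N x b) | next_in_block x pi i)
     \prod_(V in pi) c (#|V| + (x \in V) * j)%N =
  NC_sum N x.+1 i * NC_sum_first i b j.+1.
Proof.
move=> ltxi ltib; rewrite /NC_sum /NC_sum_first big_distrlr /= pair_big /=.
rewrite (reindex_onto (join_block x i) (split_block x i)); last first.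
  by move=> pi /andP[/NC_onP piNC /(split_blockK ltxi piNC)].
rewrite (eq_bigl (fun rs => (rs.1 \in NC_on (ord_interval N x.+1 i)) &&
                            (rs.2 \in NC_on (ord_interval N i b)))); last first.
  case=> rho sigma /=; apply/andP/andP => [[/andP[/NC_onP piNC nx] /eqP e]|].
    have := split_block_left ltib piNC nx; have := split_block_right ltxi piNC nx.
    by rewrite e.
  case=> /NC_onP rNC /NC_onP sNC.
  by rewrite (join_block_NC ltxi ltib rNC sNC) (join_block_next ltxi ltib _ sNC) (join_blockK ltxi rNC sNC).
apply: eq_bigr => -[rho sigma] /= /andP[/NC_onP rNC /NC_onP sNC].
by rewrite (join_block_weight ltxi rNC sNC).
Qed.

Lemma next_in_block_inj N (x i i' : 'I_N) b pi : NC_spec (ord_interval N x b) pi ->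
  next_in_block x pi i -> next_in_block x pi i' -> i = i'.
Proof.
move=> H /next_in_blockP[V [Vpi xV iV xi minV]] /next_in_blockP[W [Wpi xW iW xi' minW]].
have VW := NC_triv H Vpi Wpi xV xW; subst W.
by apply/val_inj/anti_leq; rewrite minV // minW.
Qed.

Lemma next_in_block_ex N (x : 'I_N) b pi : (x < b)%N ->
  NC_spec (ord_interval N x b) pi ->
  ([set x] \in pi) = ~~ [exists i, next_in_block x pi i].
Proof.
move=> ltxb H; apply/idP/existsPn => [xpi i|H'].
  apply/next_in_blockP => -[V [Vpi xV iV xi _]].
  move: iV; rewrite (NC_triv H Vpi xpi xV) ?set11 // => /set1P ix.
  by rewrite ix ltnn in xi.
have [|V Vpi xV] := NC_cover H (x := x); first by rewrite mem_ord_interval leqnn.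
have [k0 /andP[k0V xk0]|none] := pickP [pred k in V | (x < k)%N].
  case: (@arg_minnP _ k0 [pred k in V | (x < k)%N] (@nat_of_ord N)) => /= [|k].
    by rewrite k0V.
  case/andP=> kV xk mink; case/negP: (H' k); apply/next_in_blockP.
  by exists V; split=> // l lV xl; apply: mink; rewrite lV.
suff <- : V = [set x] by [].
apply/setP => y; rewrite inE; apply/idP/eqP => [yV|-> //].
have := NC_sub H Vpi yV; rewrite mem_ord_interval leq_eqVlt => /andP[/predU1P[xy _|xy _]].
  by apply: val_inj.
by have := none y; rewrite /= yV xy.
Qed.

(** Either [x] is alone in its block, or the block has a unique second element, by which the
    partitions are grouped. *)
Lemma NC_sum_first_rec N (x : 'I_N) b j : (x < b)%N ->
  NC_sum_first x b j = c j.+1 * NC_sum N x.+1 b +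
    \sum_(i : 'I_N | (x < i < b)%N) NC_sum N x.+1 i * NC_sum_first i b j.+1.
Proof.
move=> ltxb; rewrite -(NC_sum_singleton j ltxb) /NC_sum_first.
rewrite (bigID (fun pi : {set {set 'I_N}} => [set x] \in pi)) /=; congr (_ + _).
(* The default [x] is never reached: the partitions with the block [[set x]] have been split off. *)
pose nxt (pi : {set {set 'I_N}}) := odflt x [pick i | next_in_block x pi i].
rewrite (partition_big nxt (fun i => (x < i < b)%N)) /=; last first.
  move=> pi /andP[/NC_onP H]; rewrite (next_in_block_ex ltxb H) negbK => /existsP[i xi].
  rewrite /nxt; case: pickP => [k /=|/(_ i)]; last by rewrite xi.
  case/next_in_blockP=> V [Vpi _ kV xk _].
  by have := NC_sub H Vpi kV; rewrite mem_ord_interval => /andP[_ ->]; rewrite xk.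
apply: eq_bigr => i /andP[xi ib]; rewrite -(NC_sum_next j xi ib); apply: eq_bigl => pi.
rewrite -andbA; apply: andb_id2l => /NC_onP H; rewrite (next_in_block_ex ltxb H) negbK.
apply/andP/idP => [[ex /eqP<-]|ni].
  by case/existsP: ex => k xk; rewrite /nxt; case: pickP => // /(_ k); rewrite xk.
split; first by apply/existsP; exists i.
rewrite /nxt; case: pickP => [k /= nk|/(_ i)]; last by rewrite ni.
by apply/eqP; apply: next_in_block_inj H _ _.
Qed.

Lemma NC_sum_empty N a : NC_sum N a a = 1.
Proof.
rewrite /NC_sum (_ : ord_interval N a a = set0) ?NC_on0 ?big_set1 ?big_set0 //.
by apply/setP => y; rewrite mem_ord_interval inE; case: leqP.
Qed.

Lemma NC_sum_first0 N (x : 'I_N) b : NC_sum_first x b 0 = NC_sum N x b.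
Proof. by apply: eq_bigr => pi _; apply: eq_bigr => V _; rewrite muln0 addn0. Qed.

Let m n := NC_sum n 0 n.

(** Translation invariance turns a gap inside ['I_N] into a moment of its own length. The two claims
    are proved together: a full sum of length [L] is a first-block sum with [L - 1] further points,
    and a first-block sum with [L] further points involves full sums of length at most [L]. *)
Lemma NC_sum_translate L :
  (forall N a b, (b <= N)%N -> b = (a + L)%N -> NC_sum N a b = m L) /\
  (forall N (x : 'I_N) b j, (b <= N)%N -> b = (x + L.+1)%N ->
     NC_sum_first x b j = first_block m c L j 0).
Proof.
elim/ltn_ind: L => L IH.
have mL N a b : (b <= N)%N -> b = (a + L)%N -> NC_sum N a b = m L.
  move=> bN eb; subst b; case: L IH bN => [|L] IH bN.
    by rewrite addn0 /m !NC_sum_empty.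
  have [_ IHL] := IH L (leqnn _).
  have aN : (a < N)%N by apply: leq_trans bN; rewrite addnS ltnS leq_addr.
  have := IHL N (Ordinal aN) (a + L.+1)%N 0 bN erefl.
  rewrite NC_sum_first0 /= => ->.
  by have := IHL L.+1 ord0 L.+1 0 (leqnn _) erefl; rewrite NC_sum_first0.
split=> // N x b j bN eb; rewrite NC_sum_first_rec; last first.
  by rewrite eb -addSnnS leq_addr.
rewrite first_block_expand mL //; last by rewrite addSnnS.
congr (_ + _).
(* The reindexing by ['I_L] needs a default element, so the empty case is settled apart. *)
have [L0|L0] := posnP L.
  rewrite L0 big_ord0 big1 // => i; rewrite eb L0 addn1 ltnS => /andP[xi ix].
  by move: (leq_trans xi ix); rewrite ltnn.
have bnd (k : 'I_L) : (x.+1 + k < N)%N.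
  by rewrite (leq_trans _ bN) // eb addSnnS ltn_add2l ltnS.
rewrite (reindex_onto (fun k : 'I_L => Ordinal (bnd k))
   (fun i : 'I_N => insubd (Ordinal L0) (i - x.+1)%N)) /=; last first.
  move=> i /andP[xi ib]; apply: val_inj => /=; rewrite val_insubd.
  have e : (x.+1 + L)%N = b by rewrite addSnnS.
  by rewrite ltn_subLR // e ib subnKC.
apply: eq_big => [k|k _].
  rewrite -val_eqE /= val_insubd addKn ltn_ord eqxx andbT.
  by rewrite eb !addSnnS ltn_add2l ltnS ltn_ord -[X in (X < _)%N]addn0 ltn_add2l.
have [mk _] := IH k (ltn_ord k); rewrite (mk N x.+1) //=; last exact/ltnW/bnd.
have lt : (L - k.+1 < L)%N by rewrite ltn_subrL L0.
have [_ ->] // := IH _ lt.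
by rewrite /= eb -subSn // subSS -addnA subnKC ?addSnnS // ltnW.
Qed.

End Sums.

Lemma NC_sum_full c n : NC_sum c n 0 n = \sum_(pi in NC n) \prod_(V in pi) c #|V|.
Proof.
rewrite /NC_sum; apply: eq_bigl => pi; rewrite !inE.
suff -> : ord_interval n 0 n = [set: 'I_n] by [].
by apply/setP => i; rewrite mem_ord_interval ltn_ord inE.
Qed.

Lemma NC_sum_first_block c n :
  let m k := \sum_(pi in NC k) \prod_(V in pi) c #|V| in
  m n.+1 = first_block m c n 0 0.
Proof.
move=> m; have -> : m n.+1 = NC_sum_first c (ord0 : 'I_n.+1) n.+1 0.
  by rewrite NC_sum_first0 NC_sum_full.
have [_ ->//] := NC_sum_translate c n.
by apply: eq_first_block => k _ //; apply: NC_sum_full.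
Qed.

End FirstBlockRecursion.

(** * Words in free variables *)
Section FreePairs.
Variables (K : comNzRingType) (A : algType K) (tau : {scalar A}).
Implicit Types (x y g n : A) (s : seq A) (M : bool -> A -> Prop).

Fixpoint centered_alternating M (b : bool) s : Prop :=
  if s is x :: s' then [/\ M b x, tau x = 0 & centered_alternating M (~~ b) s'] else True.

(** The expansion is purely algebraic, so freeness is stated for two unital subalgebras without
    involution; booleans index them so that alternation is negation. *)
Record free_pair M : Prop := FreePair {
  free_pair1 : forall b, M b 1;
  free_pair_lin : forall b c x y, M b x -> M b y -> M b (c *: x + y);
  free_pair_mul : forall b x y, M b x -> M b y -> M b (x * y);
  free_pair_alt : forall b x s, centered_alternating M b (x :: s) ->
    tau (\prod_(y <- x :: s) y) = 0 }.

Definition moments (a : A) (k : nat) : K := tau (a ^+ k).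

Definition centered x := x - (tau x)%:A.

Section FirstBlock.
Variables (M : bool -> A -> Prop) (freeM : free_pair M) (tau1 : tau 1 = 1).
Variables (b : bool) (a : A) (Ma : M b a) (c : nat -> K).
Implicit Types F G : nat -> A -> K.

(* A state (j, g) of the first-block expansion of the trace of a word: the
   block has j + 1 elements so far and g is the product of the letters read
   since the last one. The word is read by composing the operators below. *)
Definition read_end : nat -> A -> K := fun j g => c j.+1 * tau g.
Definition read_var F : nat -> A -> K := fun j g => tau g * F j.+1 1 + F j (g * a).
Definition read_cst n F : nat -> A -> K := fun j g => F j (g * n).

(** A relation, because an element of [A] can be written as a word in several ways, each with its
    own reader. Under the hypothesis of [trace_word] all of them agree at the state [(0, 1)]. *)
Inductive word : A -> (nat -> A -> K) -> Prop :=
| word_nil : word 1 read_end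
| word_var x F : word x F -> word (a * x) (read_var F)
| word_cst n x F : M (~~ b) n -> word x F -> word (n * x) (read_cst n F)
| word_lin k x y F G : word x F -> word y G ->
    word (k *: x + y) (fun j g => k * F j g + G j g)
| word_ext x F G : (forall j g, F j g = G j g) -> word x F -> word x G.

Definition read_centered r F : nat -> A -> K :=
  fun j g => iter r read_var F j g - tau (a ^+ r) * F j g.

(* With flag false the next letter is a constant, with flag true it is a
   centered power of a. *)
Inductive alternating_word : bool -> seq A -> (nat -> A -> K) -> Prop :=
| altw_nil t : alternating_word t [::] read_end
| altw_cst n s F : M (~~ b) n -> tau n = 0 -> alternating_word true s F ->
    alternating_word false (n :: s) (read_cst n F)
| altw_var r s F : alternating_word false s F ->
    alternating_word true (centered (a ^+ r) :: s) (read_centered r F).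

(** Normal forms of words. The leading power of [a] stays uncentered because the trace of [a * x] is
    wanted, and the extra [a] simply raises that power. *)
Inductive spanned : A -> (nat -> A -> K) -> Prop :=
| spanned_gen r s F : alternating_word false s F ->
    spanned (a ^+ r * \prod_(y <- s) y) (iter r read_var F)
| spanned_lin k x y F G : spanned x F -> spanned y G ->
    spanned (k *: x + y) (fun j g => k * F j g + G j g)
| spanned_ext x F G : (forall j g, F j g = G j g) -> spanned x F -> spanned x G.

Definition linear_reader F :=
  forall j k g h, F j (k *: g + h) = k * F j g + F j h.

Lemma free_pairB d x y : M d x -> M d y -> M d (x - y).
Proof. by move=> dx dy; rewrite addrC -scaleN1r; apply: (free_pair_lin freeM). Qed.

Lemma free_pair_scale d k x : M d x -> M d (k *: x).
Proof.
move=> dx; have d0 : M d 0 by rewrite -(subrr 1); apply: free_pairB; apply: (free_pair1 freeM).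
by rewrite -[k *: x]addr0; apply: (free_pair_lin freeM).
Qed.

Lemma free_pairX d x r : M d x -> M d (x ^+ r).
Proof.
move=> dx; elim: r => [|r IH]; first by rewrite expr0; apply: (free_pair1 freeM).
by rewrite exprS; apply: (free_pair_mul freeM).
Qed.

Lemma free_pair_centered d x : M d x -> M d (centered x).
Proof.
move=> dx; apply: free_pairB => //; apply: free_pair_scale; exact: (free_pair1 freeM).
Qed.

Lemma tau_centered x : tau (centered x) = 0.
Proof. by rewrite linearB linearZ /= tau1 mulr1 subrr. Qed.

Lemma mulr_centered g x : g * centered x = - tau x *: g + g * x.
Proof. by rewrite mulrBr -scalerAr mulr1 scaleNr addrC. Qed.

Lemma centered_mull x g : centered x * g = x * g - tau x *: g.
Proof. by rewrite mulrBl -scalerAl mul1r. Qed.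

Lemma read_end_linear : linear_reader read_end.
Proof. by move=> j k g h; rewrite /read_end linearP /=; ring. Qed.

Lemma read_var_linear F : linear_reader F -> linear_reader (read_var F).
Proof.
move=> lF j k g h; rewrite /read_var (mulrDl (k *: g)) -scalerAl lF linearP /=; ring.
Qed.

Lemma read_cst_linear n F : linear_reader F -> linear_reader (read_cst n F).
Proof. by move=> lF j k g h; rewrite /read_cst mulrDl -scalerAl lF. Qed.

Lemma iter_read_var_linear r F : linear_reader F -> linear_reader (iter r read_var F).
Proof. by move=> lF; elim: r => //= r IH; apply: read_var_linear. Qed.

Lemma read_centered_linear r F : linear_reader F -> linear_reader (read_centered r F).
Proof.
move=> lF j k g h; rewrite /read_centered (iter_read_var_linear r lF) lF; ring.
Qed.

Lemma alternating_word_linear t s F : alternating_word t s F -> linear_reader F.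
Proof.
elim=> [_|n s' F' _ _ _ lF|r s' F' _ lF].
- exact: read_end_linear.
- exact: read_cst_linear.
- exact: read_centered_linear.
Qed.

Lemma alternating_word_alternating t s F :
  alternating_word t s F -> centered_alternating M (if t then b else ~~ b) s.
Proof.
elim=> //= [n s' F' Mn n0 _ IH|r s' F' _ IH]; split=> //.
- by rewrite negbK.
- exact/free_pair_centered/free_pairX.
- exact: tau_centered.
Qed.

(** These two predicates retain from the shape of a gap only how it pairs with centered
    continuations. After a power of [a] the continuation must be nonempty, since that power may have
    nonzero trace; after a centered constant the empty one is allowed. *)
Definition ends_in_var g := forall x s,
  centered_alternating M (~~ b) (x :: s) -> tau (g * \prod_(y <- x :: s) y) = 0.

Definition ends_in_cst g := forall s,
  centered_alternating M b s -> tau (g * \prod_(y <- s) y) = 0.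

Lemma centeredK x : x = tau x *: 1 + centered x.
Proof. by rewrite addrC subrK. Qed.

Lemma ends_in_var_exp r : ends_in_var (a ^+ r).
Proof.
move=> x s xs; rewrite (centeredK (a ^+ r)) mulrDl linearD /= -scalerAl mul1r linearZ /=.
rewrite (free_pair_alt freeM xs) mulr0 add0r -(big_cons _ _ (centered (a ^+ r)) _ xpredT id).
apply: (free_pair_alt freeM (b := b)); split=> //.
- exact/free_pair_centered/free_pairX.
- exact: tau_centered.
Qed.

Lemma ends_in_cst_mul g n :
  M (~~ b) n -> tau n = 0 -> ends_in_var g -> ends_in_cst (g * n).
Proof.
move=> Mn n0 Vg s bs; rewrite -mulrA -(big_cons _ _ n _ xpredT id).
by apply: Vg; split; rewrite ?negbK.
Qed.

Lemma ends_in_var_mul g r : ends_in_cst g -> ends_in_var (g * centered (a ^+ r)).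
Proof.
move=> Cg x s xs; rewrite -mulrA -(big_cons _ _ (centered _) _ xpredT id).
apply: Cg; split=> //.
- exact/free_pair_centered/free_pairX.
- exact: tau_centered.
Qed.

Lemma ends_in_cst_tau0 g r : ends_in_cst g -> tau (g * a ^+ r) = 0.
Proof.
move=> Cg; have := Cg [::] I; rewrite big_nil mulr1 => g0.
have /Cg : centered_alternating M b [:: centered (a ^+ r)].
  split=> //; [exact/free_pair_centered/free_pairX|exact: tau_centered].
by rewrite big_seq1 mulr_centered linearD linearZ /= g0 mulr0 add0r.
Qed.

(** The gap keeps trace zero when powers of [a] are appended to it, so at each letter the branch
    that closes the gap vanishes and only the branch that prolongs it remains. *)
Lemma iter_read_var_cst r F j g :
  ends_in_cst g -> iter r read_var F j g = F j (g * a ^+ r).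
Proof.
move=> Cg; have {Cg} g0 i := ends_in_cst_tau0 i Cg.
elim: r g g0 => [|r IH] g g0 /=; first by rewrite mulr1.
rewrite /read_var -[X in tau X](mulr1 g) -(expr0 a) g0 mul0r add0r IH => [|i].
  by rewrite -mulrA -exprS.
by rewrite -mulrA -exprS.
Qed.

Lemma alternating_word_nil t F : alternating_word t [::] F -> F = read_end.
Proof. by move=> H; inversion H. Qed.

(* The gap after the last letter of the block ends with a centered alternating
   word, so its trace vanishes. *)
Lemma alternating_word_eq0 t s F : alternating_word t s F ->
  forall j g, if t then ends_in_cst g -> F j g = 0
              else s <> [::] -> ends_in_var g -> F j g = 0.
Proof.
elim=> [[] //|n s' F' Mn n0 _ IH|r s' F' aw IH] j g.
- by move/(_ [::] I); rewrite big_nil mulr1 /read_end => ->; rewrite mulr0.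
- by move=> _ Vg; apply: (IH j (g * n)); apply: ends_in_cst_mul.
- move=> Cg; have lF := alternating_word_linear aw.
  have -> : read_centered r F' j g = F' j (g * centered (a ^+ r)).
    by rewrite mulr_centered lF /read_centered iter_read_var_cst // mulNr addrC.
  have [s0|/eqP s0] := eqVneq s' [::]; last by apply: IH => //; apply: ends_in_var_mul.
  move: aw; rewrite s0 => /alternating_word_nil->; rewrite /read_end.
  have := ends_in_cst_tau0 0 Cg; rewrite expr0 mulr1 => g0.
  by rewrite mulr_centered linearD linearZ /= g0 (ends_in_cst_tau0 _ Cg) mulr0 addr0 mulr0.
Qed.

(** Both sides are linear in the word, so the generators suffice. A pure power is the hypothesis; on
    any other generator freeness kills the trace and [alternating_word_eq0] the reader. *)
Lemma spanned_first_block :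
  (forall k, tau (a ^+ k.+1) = first_block (moments a) c k 0 0) ->
  forall x F, spanned x F -> tau (a * x) = F 0 1.
Proof.
move=> pure x F; elim=> {x F} [r s F aw|k x y F G _ IHF _ IHG|x F G e _ IH].
- rewrite mulrA -exprS; case: s aw => [|x s] aw.
    rewrite big_nil mulr1 (alternating_word_nil aw) pure.
    suff H j p : iter r read_var read_end j (a ^+ p) = first_block (moments a) c r j p.
      by rewrite -(expr0 a) H.
    elim: r j p => [|r IH] j p //=.
    by rewrite /read_var -exprSr -!IH expr0.
  rewrite ends_in_var_exp; last exact: (alternating_word_alternating aw).
  have := fun j => alternating_word_eq0 aw j (a ^+ _); move=> /= Z.
  suff H j p : iter r read_var F j (a ^+ p) = 0 by rewrite -(expr0 a) H.
  elim: r j p => [|r IH] j p /=; first by apply: Z => //; apply: ends_in_var_exp.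
  by rewrite /read_var -exprSr IH -(expr0 a) IH mulr0 addr0.
- by rewrite mulrDr -scalerAr linearP IHF IHG.
- by rewrite IH.
Qed.

Lemma spanned_alternating_word s F :
  alternating_word false s F -> spanned (\prod_(y <- s) y) F.
Proof. by move=> aw; have := spanned_gen 0 aw; rewrite mul1r. Qed.

Lemma alternating_word_falseP s F : alternating_word false s F ->
  (s = [::] /\ F = read_end) \/
  exists n s1 F1, [/\ M (~~ b) n, alternating_word true s1 F1,
                     s = n :: s1 & F = read_cst n F1].
Proof.
move E: false => t aw; case: aw E => //; first by left.
by move=> n s1 F1 Mn n0 aw _; right; exists n, s1, F1.
Qed.

Lemma alternating_word_trueP s F : alternating_word true s F ->
  (s = [::] /\ F = read_end) \/
  exists r s1 F1, [/\ alternating_word false s1 F1, s = centered (a ^+ r) :: s1 &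
                     F = read_centered r F1].
Proof.
move E: true => t aw; case: aw E => //; first by left.
by move=> r s1 F1 aw _; right; exists r, s1, F1.
Qed.

(** The new constant merges with the leading one and the product is centered again. The scalar part
    exposes the centered power behind it, which is the uncentered power minus a scalar, hence again
    of normal form. *)
Lemma spanned_cst_alternating n s F : M (~~ b) n -> alternating_word false s F ->
  spanned (n * \prod_(y <- s) y) (read_cst n F).
Proof.
move=> Mn aw; have lF := alternating_word_linear aw.
have step m s1 F1 : M (~~ b) m -> alternating_word true s1 F1 ->
    spanned (\prod_(y <- s1) y) F1 ->
    spanned (m * \prod_(y <- s1) y) (read_cst m F1).
  move=> Mm aw1 sp1; have lF1 := alternating_word_linear aw1.
  have /spanned_alternating_word sp2 : alternating_word false (centered m :: s1)
      (read_cst (centered m) F1).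
    by apply: altw_cst => //; [exact: free_pair_centered|exact: tau_centered].
  have := spanned_lin (tau m) sp1 sp2.
  rewrite big_cons centered_mull addrC subrK; apply: spanned_ext => j g.
  by rewrite /read_cst mulr_centered lF1; ring.
have [[-> ->]|[m [s1 [F1 [Mm aw1 -> ->]]]]] := alternating_word_falseP aw.
  by apply: step => //; [exact: altw_nil|exact/spanned_alternating_word/altw_nil].
rewrite big_cons mulrA.
have H : spanned (\prod_(y <- s1) y) F1.
  have [[-> ->]|[r [s2 [F2 [aw2 -> ->]]]]] := alternating_word_trueP aw1.
    exact/spanned_alternating_word/altw_nil.
  have := spanned_lin (- tau (a ^+ r)) (spanned_alternating_word aw2) (spanned_gen r aw2).
  rewrite big_cons centered_mull scaleNr addrC; apply: spanned_ext => j g.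
  by rewrite /read_centered; ring.
have := step (n * m) s1 F1 (free_pair_mul freeM Mn Mm) aw1 H.
by apply: spanned_ext => j g; rewrite /read_cst mulrA.
Qed.

Lemma spanned_cst n x F : M (~~ b) n -> spanned x F -> spanned (n * x) (read_cst n F).
Proof.
move=> Mn; elim=> {x F} [r s F aw|k x y F G _ IHF _ IHG|x F G e _ IH].
- have lF := alternating_word_linear aw; have lF' := iter_read_var_linear r lF.
  set w := \prod_(y <- s) y; set m := tau (a ^+ r).
  have sp0 := spanned_alternating_word aw.
  have sp1 := spanned_gen r aw.
  have sp2 := spanned_cst_alternating Mn aw.
  have /spanned_alternating_word sp3 :
      alternating_word false (centered n :: centered (a ^+ r) :: s)
        (read_cst (centered n) (read_centered r F)).
    apply: altw_cst; [exact: free_pair_centered|exact: tau_centered|].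
    exact: altw_var.
  (* These coefficients come from solving [centered n * centered (a ^+ r) * w], multiplied out, for
     the term [n * a ^+ r * w]. *)
  have := spanned_lin (tau n) sp1 (spanned_lin (- tau n * m) sp0 (spanned_lin m sp2 sp3)).
  have -> : tau n *: (a ^+ r * w) + (- tau n * m *: w + (m *: (n * w) +
    \prod_(y <- [:: centered n, centered (a ^+ r) & s]) y)) = n * (a ^+ r * w).
    rewrite 2!big_cons centered_mull -/w !centered_mull mulrBr -/m -scalerAr.
    rewrite scalerBr scalerA mulNr scaleNr.
    set u := _ *: (a ^+ r * w); set z := m *: _.
    by rewrite [z + _]addrA [z + _]addrC subrK [u + _]addrA addrC subrK.
  apply: spanned_ext => j g; rewrite /read_cst /read_centered mulr_centered lF' lF -/m.
  by ring.
- have := spanned_lin k IHF IHG; rewrite scalerAr -mulrDr; exact: spanned_ext.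
- by move: IH; apply: spanned_ext => j g; apply: e.
Qed.

Lemma spanned_var x F : spanned x F -> spanned (a * x) (read_var F).
Proof.
elim=> {x F} [r s F aw|k x y F G _ IHF _ IHG|x F G e _ IH].
- by rewrite mulrA -exprS; apply: (spanned_gen r.+1).
- have := spanned_lin k IHF IHG; rewrite scalerAr -mulrDr.
  by apply: spanned_ext => j g; rewrite /read_var; ring.
- by move: IH; apply: spanned_ext => j g; rewrite /read_var !e.
Qed.

Lemma word_spanned x F : word x F -> spanned x F.
Proof.
elim=> {x F} [|x F _|n x F Mn _|k x y F G _ IHF _ IHG|x F G e _].
- by have := spanned_alternating_word (altw_nil false); rewrite big_nil.
- exact: spanned_var.
- exact: spanned_cst.
- exact: spanned_lin.
- exact: spanned_ext.
Qed.

Lemma trace_word :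
  (forall k, tau (a ^+ k.+1) = first_block (moments a) c k 0 0) ->
  forall x F, word x F -> tau (a * x) = F 0 1.
Proof. by move=> pure x F /word_spanned; apply: spanned_first_block. Qed.

End FirstBlock.
End FreePairs.

(** * Additivity of free cumulants *)
Section Cumulants.
Variable K : comNzRingType.
Implicit Types m c : nat -> K.

Definition NC_moment c n : K := \sum_(pi in NC n) \prod_(V in pi) c #|V|.

Lemma NC_moment0 c : NC_moment c 0 = 1.
Proof. by rewrite /NC_moment -NC_sum_full NC_sum_empty. Qed.

Lemma moments_first_block m n : m 0%N = 1 ->
  m n.+1 = first_block m (free_cumulant m) n 0 0.
Proof.
move=> m0; have mE k : m k = NC_moment (free_cumulant m) k.
  by case: k => [|k]; [rewrite NC_moment0|exact: moment_cumulant].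
by rewrite mE [LHS]NC_sum_first_block; apply: eq_first_block.
Qed.

Lemma first_block_moment m c : m 0%N = 1 ->
  (forall n, m n.+1 = first_block m c n 0 0) -> m =1 NC_moment c.
Proof.
move=> m0 mS; elim/ltn_ind => -[|n] IH; first by rewrite NC_moment0.
rewrite mS [RHS]NC_sum_first_block; apply: eq_first_block => k kn //.
by rewrite IH.
Qed.

(** Cumulants can be recognised from the recursion; additivity and homogeneity are both obtained
    this way. *)
Lemma free_cumulant_first_block m c : m 0%N = 1 ->
  (forall n, m n.+1 = first_block m c n 0 0) ->
  forall n, (0 < n)%N -> free_cumulant m n = c n.
Proof.
move=> m0 mS; apply: free_cumulant_unique => n _.
exact: first_block_moment.
Qed.

Lemma eq_free_cumulant m m' : m 0%N = 1 -> m =1 m' ->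
  forall n, (0 < n)%N -> free_cumulant m n = free_cumulant m' n.
Proof.
move=> m0 e; apply: free_cumulant_first_block => // n; rewrite e moments_first_block -?e //.
by apply: eq_first_block => // k _; rewrite e.
Qed.

Lemma first_blockD m c c' n j p :
  first_block m (fun k => c k + c' k) n j p =
  first_block m c n j p + first_block m c' n j p.
Proof. by elim: n j p => [|n IH] j p /=; rewrite ?IH; ring. Qed.

Lemma first_block_homogeneous z m c n j p :
  first_block (fun k => z ^+ k * m k) (fun k => z ^+ k * c k) n j p =
  z ^+ (p + n + j.+1) * first_block m c n j p.
Proof.
elim: n j p => [|n IH] j p /=; first by rewrite addn0 addnC exprD; ring.
rewrite !IH add0n addSnnS.
have -> : (p + n.+1 + j.+1)%N = (p + (n + j.+2))%N by rewrite !addnS !addnA.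
rewrite (exprD z p); ring.
Qed.

Lemma free_cumulant_scale z m : m 0%N = 1 ->
  forall n, (0 < n)%N ->
  free_cumulant (fun k => z ^+ k * m k) n = z ^+ n * free_cumulant m n.
Proof.
move=> m0; apply: (@free_cumulant_first_block (fun k => z ^+ k * m k)
  (fun k => z ^+ k * free_cumulant m k)) => [|n]; first by rewrite expr0 mul1r.
by rewrite first_block_homogeneous add0n addn1 (moments_first_block _ m0).
Qed.

Definition even_part c k : K := if odd k then 0 else c k.

Lemma NC_moment_even_odd c n : odd n -> NC_moment (even_part c) n = 0.
Proof.
move=> on; apply: big1 => pi; rewrite inE => /andP[pip _].
apply/eqP/contraT => nz; move: on.
have : (2 %| \sum_(V in pi) #|V|)%N.
  apply: dvdn_sum => V Vpi; rewrite dvdn2.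
  by apply: contraNN nz => oV; rewrite (bigD1 V) //= /even_part oV mul0r.
by rewrite -(card_partition pip) cardsT card_ord dvdn2 => /negPf->.
Qed.

(** The [j + 1] points of the block, the [p] points of the open gap and the [n] remaining ones are
    even in number. A block completed to odd size therefore leaves an odd gap, whose moment is zero,
    so the odd values of [c] do not matter. *)
Lemma first_block_even_part c n j p : odd (n + j + p) ->
  first_block (NC_moment (even_part c)) (even_part c) n j p =
  first_block (NC_moment (even_part c)) c n j p.
Proof.
elim: n j p => [|n IH] j p /=.
  rewrite add0n oddD /even_part /=; case: (boolP (odd j)) => //= oj op.
  by rewrite [NC_moment _ p]NC_moment_even_odd ?mulr0.
move=> h.
rewrite (IH j p.+1); last by rewrite addnS.
congr (_ + _); have [op|ep] := boolP (odd p).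
  by rewrite NC_moment_even_odd // !mul0r.
by rewrite IH // addn0 addnS; move: h; rewrite oddD (negPf ep) addbF.
Qed.

(** In this form the recursion comes out of the traces at [e^t = 0]: all cumulants of [S] occur, and
    only the gaps enforce parity. *)
Lemma NC_moment_even_first_block c n : odd n ->
  NC_moment (even_part c) n.+1 = first_block (NC_moment (even_part c)) c n 0 0.
Proof.
move=> on; rewrite -first_block_even_part ?addn0 //; exact: NC_sum_first_block.
Qed.

End Cumulants.

Lemma free_cumulant_rmorph (K L : comNzRingType) (f : {rmorphism K -> L})
    (m : nat -> K) n : (0 < n)%N ->
  free_cumulant (fun k => f (m k)) n = f (free_cumulant m n).
Proof.
move: n; apply: (@free_cumulant_unique _ (fun k => f (m k))
  (fun k => f (free_cumulant m k))) => n n0.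
rewrite [in LHS](moment_cumulant _ n0) rmorph_sum; apply: eq_bigr => pi _.
exact: rmorph_prod.
Qed.

Section FreeSum.
Variables (K : comNzRingType) (A : algType K) (tau : {scalar A}).
Variables (M : bool -> A -> Prop) (freeM : free_pair tau M) (tau1 : tau 1 = 1).

Lemma free_first_block b a : M b a ->
  forall x F, word tau M b a (free_cumulant (moments tau a)) x F -> tau (a * x) = F 0%N 1.
Proof.
move=> Ma x F; apply: (trace_word freeM tau1 Ma) => k.
by apply: (@moments_first_block _ (moments tau a)); rewrite /moments expr0.
Qed.

(** Here [a] is the letter and [a'] a constant. At each factor [a + a'] either [a] joins the block
    or the whole factor enters the gap, so every gap is a power of [a + a']. *)
Lemma trace_mulr_expD b a a' c : M b a -> M (~~ b) a' ->
  forall n, exists2 F, word tau M b a c ((a + a') ^+ n) F &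
    linear_reader F /\
    forall j p, F j ((a + a') ^+ p) = first_block (moments tau (a + a')) c n j p.
Proof.
move=> Ma Ma'; elim=> [|n [F wF [lF FE]]].
  exists (read_end tau c); first by rewrite expr0; apply: word_nil.
  by split=> //; apply: read_end_linear.
exists (fun j g => tau g * F j.+1 1 + F j (g * (a + a'))).
  have := word_lin 1 (word_var wF) (word_cst Ma' wF).
  rewrite scale1r -mulrDl -exprS; apply: word_ext => j g.
  rewrite /read_var /read_cst (mulrDr g) -[X in F j (X + _)]scale1r lF; ring.
split=> [j k g h|j p /=].
  by rewrite (mulrDl (k *: g)) -scalerAl lF linearP /=; ring.
by rewrite -exprSr -!FE expr0.
Qed.

Lemma free_cumulantD b a a' : M b a -> M (~~ b) a' ->
  forall n, (0 < n)%N ->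
  free_cumulant (moments tau (a + a')) n =
  free_cumulant (moments tau a) n + free_cumulant (moments tau a') n.
Proof.
move=> Ma Ma'; apply: (@free_cumulant_first_block _ (moments tau (a + a'))
  (fun k => free_cumulant (moments tau a) k + free_cumulant (moments tau a') k))
  => [|n]; first by rewrite /moments expr0.
(* The first factor is [a] or [a']; the two expansions have the same gaps and add up in their
   cumulants. *)
rewrite first_blockD {1}/moments exprS mulrDl linearD /=; congr (_ + _).
  have [F wF [_ FE]] := trace_mulr_expD (free_cumulant (moments tau a)) Ma Ma' n.
  by rewrite (free_first_block Ma wF) -FE expr0.
have Ma2 : M (~~ ~~ b) a by rewrite negbK.
have [F wF [_ FE]] := trace_mulr_expD (free_cumulant (moments tau a')) Ma' Ma2 n.
move: wF FE; rewrite [a' + a]addrC => wF FE.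
by rewrite (free_first_block Ma' wF) -FE expr0.
Qed.

End FreeSum.

From mathcomp Require Import all_classical all_reals all_analysis.
From mathcomp Require Import complex.
From mathcomp Require polyrcf.

(** * Words in a symmetry and a free unitary Brownian motion *)
Local Open Scope complex_scope.

Definition symmetry_moment (R : pzRingType) (alpha : R) (k : nat) : R :=
  if odd k then alpha else 1.

Definition symmetry_cumulant (R : comNzRingType) (alpha : R) : nat -> R :=
  free_cumulant (symmetry_moment alpha).

(* The moments of Y_t are exp (- k t / 2) times brownian_poly k. *)
Definition brownian_poly (R : fieldType) (k : nat) : {poly R} :=
  if k is j.+1 then k%:R^-1 *: (laguerre R 1 j \Po (k%:R *: 'X)) else 1.

(** The Laguerre polynomial of degree [k - 1] and parameter 1 takes the value [C(k, k - 1) = k] at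
    0, which the prefactor [1/k] cancels. *)
Lemma brownian_poly0 (R : numFieldType) k : (brownian_poly R k).[0] = 1.
Proof.
case: k => [|k]; first by rewrite hornerC.
rewrite hornerZ horner_comp !hornerE horner_coef0 coef_poly /=.
by rewrite subn0 addn1 binSn expr0 mul1r fact0 divr1 mulVf // pnatr_eq0.
Qed.

Section Model.
Variables (R : realType) (alpha : R).
Local Notation C := R[i].

(** The algebraic data of the trace computation, with the adjoint of [Y_t] entering as an inverse
    that has the same moments. [alpha] is fixed outside, so polynomials can be built before any
    space is given. *)
Record model := Model {
  model_alg : algType C;
  model_tau : {scalar model_alg};
  model_set : bool -> model_alg -> Prop;
  model_sym : model_alg;
  model_bm : R -> model_alg;
  model_inv : R -> model_alg;
  model_free : free_pair model_tau model_set;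
  model_tau1 : model_tau 1 = 1;
  model_tauC : forall x y, model_tau (x * y) = model_tau (y * x);
  model_symM : model_set true model_sym;
  model_bmM : forall t, 0 <= t -> model_set false (model_bm t);
  model_invM : forall t, 0 <= t -> model_set false (model_inv t);
  model_sym2 : model_sym * model_sym = 1;
  model_sym_tau : model_tau model_sym = alpha%:C;
  model_bmV : forall t, 0 <= t -> model_bm t * model_inv t = 1;
  model_Vbm : forall t, 0 <= t -> model_inv t * model_bm t = 1;
  model_bm_tau : forall t k, 0 <= t ->
    model_tau (model_bm t ^+ k) =
    (expR (- (k%:R / 2 * t)) * (brownian_poly R k).[t])%:C;
  model_inv_tau : forall t k, 0 <= t ->
    model_tau (model_inv t ^+ k) =
    (expR (- (k%:R / 2 * t)) * (brownian_poly R k).[t])%:C }.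

Arguments model_set : clear implicits.

Definition zpow (mo : model) (t : R) (k : int) : model_alg mo :=
  match k with Posz n => model_bm mo t ^+ n | Negz n => model_inv mo t ^+ n.+1 end.

Lemma zpowS mo t k : 0 <= t -> zpow mo t (k + 1) = zpow mo t k * model_bm mo t.
Proof.
move=> t0; case: k => n; first by rewrite -PoszD addn1 /= exprSr.
rewrite NegzE -[n.+1]addn1 PoszD opprD subrK -NegzE; case: n => [|n].
  by rewrite /= model_Vbm.
have -> : - n.+1%:Z = Negz n by rewrite NegzE.
by rewrite /= addn0 (exprSr _ n.+1) -mulrA model_Vbm ?mulr1.
Qed.

Lemma zpowD mo t k l : 0 <= t -> zpow mo t (k + l) = zpow mo t k * zpow mo t l.
Proof.
move=> t0; have zpowB n : zpow mo t (n - 1) = zpow mo t n * model_inv mo t.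
  by rewrite -{2}(subrK 1 n) zpowS // -mulrA model_bmV ?mulr1.
elim: l => [|n IH|n IH]; first by rewrite addr0 mulr1.
  by rewrite -addn1 PoszD addrA !zpowS // IH mulrA.
by rewrite -addn1 PoszD opprD addrA !zpowB IH mulrA.
Qed.

Lemma zpow_mem (mo : model) t k : 0 <= t -> model_set mo false (zpow mo t k).
Proof.
move=> t0; case: k => n; apply: (free_pairX (model_free mo)).
  exact: model_bmM.
exact: model_invM.
Qed.

Definition sym_word mo t (l : seq int) : model_alg mo :=
  \prod_(k <- l) (model_sym mo * zpow mo t k).

Definition read_word mo t (l : seq int) : nat -> model_alg mo -> C :=
  foldr (fun k F => read_var (model_tau mo) (model_sym mo) (read_cst (zpow mo t k) F))
    (read_end (model_tau mo) (fun n => (symmetry_cumulant alpha n)%:C)) l.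

Arguments read_word : clear implicits.

Lemma word_sym_word mo t l : 0 <= t ->
  word (model_tau mo) (model_set mo) true (model_sym mo)
    (fun n => (symmetry_cumulant alpha n)%:C) (sym_word mo t l) (read_word mo t l).
Proof.
move=> t0; elim: l => [|k l IH]; first by rewrite /sym_word big_nil; apply: word_nil.
rewrite /sym_word big_cons -mulrA; apply: word_var; apply: word_cst => //.
exact: zpow_mem.
Qed.

Lemma symX mo k : model_sym mo ^+ k = if odd k then model_sym mo else 1.
Proof.
elim: k => [|k IH]; first by rewrite expr0.
by rewrite exprS IH /=; case: (odd k); rewrite /= ?mulr1 ?model_sym2.
Qed.

Lemma moments_sym mo k :
  moments (model_tau mo) (model_sym mo) k = (symmetry_moment alpha k)%:C.
Proof.
rewrite /moments symX /symmetry_moment; case: odd; first exact: model_sym_tau.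
by rewrite model_tau1 rmorph1.
Qed.

Lemma cumulant_sym mo n : (0 < n)%N ->
  free_cumulant (moments (model_tau mo) (model_sym mo)) n =
  (symmetry_cumulant alpha n)%:C.
Proof.
move=> n0; rewrite -[RHS](free_cumulant_rmorph (real_complex R)) //.
apply: eq_free_cumulant => //; first by rewrite /moments expr0 model_tau1.
exact: moments_sym.
Qed.

Lemma trace_sym_word mo t k l : 0 <= t ->
  model_tau mo (sym_word mo t (k :: l)) = read_word mo t l 0%N (zpow mo t k).
Proof.
move=> t0; rewrite /sym_word big_cons -mulrA.
have wF := word_cst (b := true) (zpow_mem mo k t0) (word_sym_word mo l t0).
have pure n : model_tau mo (model_sym mo ^+ n.+1) =
    first_block (moments (model_tau mo) (model_sym mo))
      (fun n => (symmetry_cumulant alpha n)%:C) n 0 0.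
  rewrite -/(moments _ _ _) moments_first_block; last by rewrite /moments expr0 model_tau1.
  by apply: eq_first_block => // j _; rewrite cumulant_sym.
by rewrite (trace_word (model_free mo) (model_tau1 mo) (model_symM mo) pure wF) /read_cst mul1r.
Qed.

(* W is chosen before the model, hence f(t) is the same in all models. *)
Definition exp_bipoly (d : nat) (f : model -> R -> C) (W : {poly {poly R}}) : Prop :=
  ((size W).*2 <= d.+2)%N /\
  forall mo t, 0 <= t ->
    (expR (d%:R / 2 * t))%:C * f mo t = (W.[(expR t)%:P].[t])%:C.

Lemma exp_bipolyD d f g V W : exp_bipoly d f V -> exp_bipoly d g W ->
  exp_bipoly d (fun mo t => f mo t + g mo t) (V + W).
Proof.
move=> [sV eV] [sW eW]; split.
  have := size_polyD V W; move: sV sW; case: (leqP (size V) (size W)); lia.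
by move=> mo t t0; rewrite mulrDr eV // eW // !hornerD rmorphD.
Qed.

Lemma exp_bipolyM d e f g V W : exp_bipoly d f V -> exp_bipoly e g W ->
  exp_bipoly (d + e) (fun mo t => f mo t * g mo t) (V * W).
Proof.
move=> [sV eV] [sW eW]; split.
  by have := size_polyMleq V W; move: sV sW; lia.
move=> mo t t0; rewrite !hornerM rmorphM /= -(eV mo t t0) -(eW mo t t0) natrD 2!mulrDl expRD rmorphM /=.
by ring.
Qed.

Lemma exp_bipoly_const k : exp_bipoly 0 (fun _ _ => k%:C) k%:P%:P.
Proof.
split=> [|mo t t0]; first by rewrite size_polyC; case: (_ != 0).
by rewrite !hornerC !mul0r expR0 mul1r.
Qed.

(** Normalising by more than the word needs leaves a power of [e^t]; the divisibility of odd gaps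
    comes from here. *)
Lemma exp_bipoly_shift d e f W : exp_bipoly d f W ->
  exp_bipoly (d + e.*2) f (W * 'X^e).
Proof.
move=> [sW eW]; split.
  have := size_polyMleq W 'X^e; rewrite size_polyXn; move: sW; lia.
move=> mo t t0; rewrite hornerM hornerXn -rmorphXn hornerM hornerC /= rmorphM /= -(eW mo t t0).
rewrite -expRM_natl natrD 2!mulrDl expRD rmorphM /= -muln2 natrM mulfK ?pnatr_eq0 //.
by rewrite mulrAC -!mulrA; congr (_ * _); rewrite mulrC.
Qed.

Lemma eq_exp_bipoly d f g W :
  (forall mo t, 0 <= t -> f mo t = g mo t) -> exp_bipoly d f W -> exp_bipoly d g W.
Proof. by move=> e [sW eW]; split=> // mo t t0; rewrite -e // eW. Qed.

Lemma exp_bipoly_zpow k :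
  exp_bipoly `|k|%N (fun mo t => model_tau mo (zpow mo t k)) (brownian_poly R `|k|)%:P.
Proof.
split=> [|mo t t0]; first by rewrite size_polyC; case: (_ != 0).
rewrite hornerC; have E n : expR (n%:R / 2 * t) * (expR (- (n%:R / 2 * t)) *
    (brownian_poly R n).[t]) = (brownian_poly R n).[t].
  by rewrite mulrA -expRD subrr expR0 mul1r.
by case: k => n; rewrite /zpow ?model_bm_tau ?model_inv_tau // -rmorphM /= ?E.
Qed.

Definition weight (l : seq int) : nat := \sum_(k <- l) `|k|%N.

Definition alternates (k : int) (l : seq int) : bool :=
  all (fun i : int => i != 0) (k :: l) &&
  path (fun i j : int => (j < 0) == ~~ (i < 0)) k l.

Lemma alternates_last k l : alternates k l ->
  (last k l < 0) = (k < 0) (+) odd (size l).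
Proof.
case/andP=> _; elim: l k => [|i l IH] k /=; first by rewrite addbF.
by case/andP=> /eqP ik /IH ->; rewrite ik; case: (k < 0); case: odd.
Qed.

Lemma alternates_cat k l1 i l2 : alternates k (l1 ++ i :: l2) ->
  alternates k l1 && alternates i l2.
Proof.
rewrite /alternates cat_path /= all_cat /=.
by case/andP=> /and4P[-> -> -> ->] /and3P[-> _ ->].
Qed.

Definition constant_value (W : {poly {poly R}}) : R := (W`_0).[0].

Lemma constant_valueM V W :
  constant_value (V * W) = constant_value V * constant_value W.
Proof. by rewrite /constant_value coef0M hornerM. Qed.

Local Notation evenm := (NC_moment (even_part (symmetry_cumulant alpha))).

(** Alternation is required for the value alone: merging two exponents can destroy it, and the
    exponential form must still be available then. *)
Definition gap_spec (k : int) (l : seq int) : Prop :=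
  exists2 W, exp_bipoly (`|k| + weight l)
      (fun mo t => model_tau mo (zpow mo t k * sym_word mo t l)) W
    & alternates k l -> constant_value W = evenm (size l).

(** [g] is the part of the word already absorbed by the open gap and [l] the unread part. Their
    joint length stays below [n], so each gap that may get closed is covered by the hypothesis. *)
Lemma read_word_spec n l j k g :
  (forall k' g', (size g' < n)%N -> gap_spec k' g') -> (size g + size l < n)%N ->
  exists2 W, exp_bipoly (`|k| + weight g + weight l)
      (fun mo t => read_word mo t l j (zpow mo t k * sym_word mo t g)) W
    & alternates k (g ++ l) -> constant_value W =
        first_block evenm (symmetry_cumulant alpha) (size l) j (size g).
Proof.
move=> gaps; elim: l j k g => [|i l IH] j k g sz.
  have [|W eW cW] := gaps k g; first by rewrite addn0 in sz.
  exists ((symmetry_cumulant alpha j.+1)%:P%:P * W); last first.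
    by rewrite cats0 constant_valueM => /cW->; rewrite /constant_value !coefC hornerC.
  rewrite /weight big_nil addn0 -[(`|k| + _)%N]add0n.
  exact: exp_bipolyM (exp_bipoly_const _) eW.
have [|W1 e1 c1] := gaps k g; first by move: sz => /=; lia.
have [|W2 e2 c2] := IH j.+1 i [::]; first by move: sz => /=; lia.
have [|W3 e3 c3] := IH j k (rcons g i); first by move: sz; rewrite size_rcons /=; lia.
exists (W1 * W2 + W3).
  have -> : (`|k| + weight g + weight (i :: l) =
             `|k| + weight g + (`|i| + weight [::] + weight l))%N.
    by rewrite /weight big_cons big_nil addn0.
  apply: exp_bipolyD; last first.
    have -> : (`|k| + weight g + (`|i| + weight [::] + weight l) =
               `|k| + weight (rcons g i) + weight l)%N.
      by rewrite /weight -cats1 big_cat big_seq1 big_nil /=; lia.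
    apply: eq_exp_bipoly e3 => mo t t0.
    by rewrite /read_cst /sym_word -cats1 big_cat big_seq1 /= !mulrA.
  apply: eq_exp_bipoly (exp_bipolyM e1 e2) => mo t t0.
  by rewrite /read_cst /sym_word big_nil mulr1 mul1r.
move=> alt; have /andP[alt1 alt2] := alternates_cat alt.
rewrite /constant_value coefD hornerD -/(constant_value _) constant_valueM c1 // c2 //.
by rewrite -/(constant_value _) c3 ?cat_rcons // size_rcons.
Qed.

Lemma sym_word_spec n k l :
  (forall k' g', (size g' < n)%N -> gap_spec k' g') -> (size l < n)%N ->
  exists2 W, exp_bipoly (weight (k :: l))
      (fun mo t => model_tau mo (sym_word mo t (k :: l))) W
    & alternates k l -> constant_value W =
        first_block evenm (symmetry_cumulant alpha) (size l) 0 0.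
Proof.
move=> gaps sz; have [//|W eW cW] := read_word_spec 0 k gaps (g := [::]) (l := l).
exists W => //; have -> : weight (k :: l) = (`|k| + weight [::] + weight l)%N.
  by rewrite /weight big_cons big_nil addn0.
apply: eq_exp_bipoly eW => mo t t0.
by rewrite trace_sym_word // /sym_word big_nil mulr1.
Qed.

(** Once traciality has merged the end exponents, the word starts with [S] and can be expanded. Its
    first [S] belongs to the block, so every gap has fewer letters [S]. *)
Lemma gap_specP k l : gap_spec k l.
Proof.
elim/ltn_ind: {l}(size l) {-2}l (erefl (size l)) k => n IH l sl k.
have gaps k' g' : (size g' < n)%N -> gap_spec k' g' by move/IH; apply.
case/lastP: l sl => [|g k'] sl.
  exists (brownian_poly R `|k|)%:P; last first.
    by move=> _; rewrite NC_moment0 /constant_value coefC brownian_poly0.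
  rewrite /weight big_nil addn0; apply: eq_exp_bipoly (exp_bipoly_zpow k) => mo t t0.
  by rewrite /sym_word big_nil mulr1.
move: sl; rewrite size_rcons => sl; subst n.
have eW0 mo t : 0 <= t -> model_tau mo (sym_word mo t (rcons g (k' + k))) =
    model_tau mo (zpow mo t k * sym_word mo t (rcons g k')).
  move=> t0; rewrite model_tauC /sym_word -!cats1 !big_cat !big_seq1 /=.
  by rewrite zpowD // !mulrA.
(* Cancellation lowers the weight by an even number [e.*2], which leaves the factor [(e^t)^e]. *)
pose e := ((`|k| + `|k'| - `|(k' + k)%R|)%N)./2.
have ee : (`|k| + `|k'| = `|(k' + k)%R| + e.*2)%N.
  by rewrite /e; lia.
have wE : (`|k| + weight (rcons g k') = weight (rcons g (k' + k)%R) + e.*2)%N.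
  by rewrite /weight -!cats1 !big_cat !big_seq1 /=; lia.
have [i [h gh]] : exists i h, rcons g (k' + k) = i :: h.
  by case: (g) => [|i h]; [exists (k' + k), [::]|exists i, (rcons h (k' + k))].
have sh : size h = size g by have := congr1 size gh; rewrite size_rcons /= => -[].
have [|W eW cW] := sym_word_spec i gaps (l := h); first by rewrite sh.
exists (W * 'X^e).
  rewrite wE gh; apply: exp_bipoly_shift; apply: eq_exp_bipoly eW => mo t t0.
  by rewrite -gh eW0.
rewrite size_rcons => alt; have := alternates_last alt.
rewrite last_rcons size_rcons /= => sg.
have [k0 k'0] : k != 0 /\ k' != 0.
  by case/andP: alt => /= /andP[-> ]; rewrite all_rcons => /andP[-> _].
(* For odd [size g] the end exponents have the same sign: nothing cancels and the merged word still
   alternates. *)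
rewrite constant_valueM; have [og|eg] := boolP (odd (size g)).
  have e0 : e = 0%N.
    move: sg; rewrite og addbF => sg; rewrite /e.
    by case: ltP sg => h1; case: ltP => h2; lia.
  have alt' : alternates i h.
    have g0 : g <> [::] by case: (g) og.
    case: (g) gh alt sg og g0 => [//|i' h'] [<- <-] alt sg og _; move: alt.
    rewrite /alternates /= !rcons_path !all_rcons -!andbA.
    case/and5P=> _ -> _ -> /and3P[_ -> /eqP kl] /=.
    move: sg; rewrite og addbF => sg.
    apply/andP; split; first by lia.
    by apply/eqP; rewrite -kl; lia.
  rewrite cW // (NC_moment_even_first_block _ og) sh e0 expr0.
  by rewrite /constant_value coefC hornerC mulr1.
(* Opposite signs at the ends: [e] is positive, and the value 0 agrees with the odd moment. *)
rewrite NC_moment_even_odd //= [X in _ * X](_ : _ = 0) ?mulr0 //.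
have : (0 < e)%N by move: sg; rewrite (negPf eg) addbT /e; lia.
by case: (e) => // e' _; rewrite /constant_value coefXn hornerC.
Qed.

End Model.

(** * Uniqueness of exponential polynomials *)
Section ExpTranscendence.
Variable R : realType.
Implicit Types (p q : {poly R}) (t : R) (W : {poly {poly R}}).

Definition abs_poly p : {poly R} := \poly_(i < size p) `|p`_i|.

Lemma horner_abs_poly p t : 0 <= t -> `|p.[t]| <= (abs_poly p).[t].
Proof.
move=> t0; rewrite [p.[t]]horner_coef horner_poly; apply: le_trans (ler_norm_sum _ _ _) _.
by apply: ler_sum => i _; rewrite normrM [`|t ^+ i|]ger0_norm ?exprn_ge0.
Qed.

Lemma poly_ge0_lead_coef p : (forall t : R, 0 <= t -> 0 <= p.[t]) -> 0 <= lead_coef p.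
Proof.
move=> p0; rewrite leNgt; apply/negP => lp.
have [|n Hn] := @polyrcf.poly_pinfty_gt_lc R (- p); first by rewrite lead_coefN oppr_gt0.
have := Hn (Num.max n 0); rewrite le_max lexx /= => /(_ isT).
rewrite lead_coefN hornerN lerN2 => h.
have := p0 (Num.max n 0); rewrite le_max lexx orbT => /(_ isT) /le_trans /(_ h).
by rewrite leNgt lp.
Qed.

(** From [expR t >= t^m / m!] the polynomial [r] is nonnegative on the half-line. With [m] beyond
    the size of [q] and [p] nonzero, its leading term is that of [- p^2 X^(2m)], hence negative.
    Squaring removes the absolute value. *)
Lemma exp_poly_dominated p q :
  (forall t : R, 0 <= t -> `|p.[t]| * expR t <= q.[t]) -> p = 0.
Proof.
move=> dom; apply/eqP/contraT => p0; pose m := (size q).+1.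
have fm0 : 0 < m`!%:R :> R by rewrite ltr0n fact_gt0.
pose r : {poly R} := m`!%:R ^+ 2 *: q ^+ 2 - p ^+ 2 * 'X^(m.*2).
have /poly_ge0_lead_coef : forall t : R, 0 <= t -> 0 <= r.[t].
  move=> t t0; rewrite /r hornerD hornerN hornerZ horner_exp (hornerM (p ^+ 2)) !horner_exp hornerX subr_ge0.
  rewrite -addnn exprD -expr2 -!exprMn -[p.[t] * _]/(p.[t] * t ^+ m).
  have lhs : `|p.[t] * t ^+ m| <= m`!%:R * q.[t].
    rewrite normrM [`|t ^+ m|]ger0_norm ?exprn_ge0 //.
    apply: le_trans (_ : m`!%:R * (`|p.[t]| * expR t) <= _); last first.
      by rewrite ler_pM2l // dom.
    rewrite mulrCA ler_wpM2l // mulrC -ler_pdivrMr //.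
    by apply: le_trans (expR_ge1Dxn (size q) t0); rewrite -/m lerDr.
  by rewrite -[leLHS]real_normK ?num_real // lerXn2r ?nnegrE // (le_trans _ lhs).
have sq : (size (m`!%:R ^+ 2 *: q ^+ 2)%R < size (p ^+ 2 * 'X^(m.*2))%R)%N.
  rewrite size_mulXn ?expf_neq0 //.
  apply: leq_ltn_trans (size_scale_leq _ _) _.
  have := size_polyMleq q q; rewrite -expr2 => h.
  have : (0 < size (p ^+ 2))%N by rewrite size_poly_gt0 expf_neq0.
  by move: h; rewrite /m; lia.
rewrite /r lead_coefDr ?size_polyN // lead_coefN lead_coef_Mmonic ?monicXn //.
rewrite lead_coef_exp oppr_ge0 leNgt exprn_even_gt0 //= lead_coef_eq0.
by rewrite p0.
Qed.

(** The top power of [expR t] exceeds every lower one by a factor of at least [expR t], so its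
    coefficient would be dominated in the sense of [exp_poly_dominated]. *)
Lemma exp_transcendental W :
  (forall t : R, 0 <= t -> W.[(expR t)%:P].[t] = 0) -> W = 0.
Proof.
move=> W0; apply/eqP/contraT => nzW; rewrite -lead_coef_eq0 in nzW.
pose N := (size W).-1.
have sW : size W = N.+1 by rewrite prednK // size_poly_gt0 -lead_coef_eq0.
case/eqP: nzW; apply: (@exp_poly_dominated _ (\sum_(k < N) abs_poly W`_k)) => t t0.
have := W0 t t0; rewrite (horner_coef W) sW big_ord_recr /= hornerD horner_sum.
move/eqP; rewrite addrC addr_eq0 => /eqP E.
have eN : 0 < expR t ^+ N by rewrite exprn_gt0 // expR_gt0.
rewrite -(ler_pM2r eN) -mulrA [expR t * _]mulrC mulrA.
have -> : `|(lead_coef W).[t]| * expR t ^+ N = `|(W`_N * (expR t)%:P ^+ N).[t]|.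
  by rewrite hornerM -polyC_exp hornerC normrM [`|expR t ^+ N|]gtr0_norm // lead_coefE.
rewrite E normrN horner_sum !mulr_suml.
apply: le_trans (_ : (\sum_(k < N) `|(W`_k * (expR t)%:P ^+ k).[t]|) * expR t <= _).
  by rewrite ler_wpM2r ?expR_ge0 // ler_norm_sum.
rewrite mulr_suml; apply: ler_sum => k _.
rewrite hornerM -polyC_exp hornerC normrM [`|expR t ^+ k|]gtr0_norm ?exprn_gt0 ?expR_gt0 //.
rewrite -mulrA -exprSr; apply: ler_pM; rewrite ?exprn_ge0 ?expR_ge0 //; first exact: horner_abs_poly.
by rewrite ler_weXn2l // -[leLHS](expR0 R) ler_expR.
Qed.

Lemma exp_poly_form_unique n (s : R -> R[i]) (P P' : {poly R}) Q Q' :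
  exp_poly_form n s P Q -> exp_poly_form n s P' Q' -> P = P'.
Proof.
move=> H H'; pose W : {poly {poly R}} :=
  (P - P')%:P + \sum_(1 <= k < n.+1) (Q k - Q' k)%:P * 'X^k.
have : W = 0.
  apply: exp_transcendental => t t0; have := H t t0; rewrite (H' t t0).
  move/complexI/eqP; rewrite -subr_eq0 => /eqP E; rewrite -[RHS]oppr0 -E opprB.
  rewrite /W hornerD hornerC 2!hornerD hornerN horner_sum horner_sum.
  rewrite opprD addrACA -sumrB; congr (_ + _); apply: eq_bigr => k _.
  by rewrite hornerM hornerC hornerXn -polyC_exp hornerM hornerC hornerD hornerN expRM_natl mulrC mulrBr.
move/(congr1 (fun V : {poly {poly R}} => V`_0)); rewrite coef0 coefD coefC /= coef_sum.
rewrite big_nat big1 ?addr0 => [/eqP|k /andP[k0 _]]; first by rewrite subr_eq0 => /eqP.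
by rewrite coefCM coefXn ltn_eqF ?mulr0.
Qed.

End ExpTranscendence.

(** * The constant term *)
(** Changing the sign of [alpha] replaces the symmetry by its negative, which multiplies the
    cumulant of order [n] by [(-1)^n]. *)
Lemma even_part_symmetry_cumulant (R : comNzRingType) (alpha : R) (b : bool) n :
  even_part (symmetry_cumulant ((-1) ^+ b * alpha)) n =
  even_part (symmetry_cumulant alpha) n.
Proof.
case: b; rewrite ?mul1r // expr1 mulN1r; case: n => [//|n].
rewrite /even_part; case: ifPn => // en.
rewrite /symmetry_cumulant.
rewrite (@eq_free_cumulant _ _ (fun k => (-1) ^+ k * symmetry_moment alpha k)) //.
  by rewrite free_cumulant_scale // -signr_odd (negPf en) mul1r.
by move=> k; rewrite /symmetry_moment -signr_odd; case: odd; rewrite ?mulN1r ?mul1r.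
Qed.

(** * The word with exponents 1, -1, 1, -1, .. *)

Section ExpForm.
Variables (R : realType) (alpha : R).

Definition alternating_exponents n : seq int := flatten (nseq n [:: 1; -1]).

Lemma alternates_exponents n : alternates 1 (-1 :: alternating_exponents n).
Proof. by rewrite /alternates; elim: n => //= n /andP[-> ->]. Qed.

Lemma size_alternating_exponents n : size (alternating_exponents n) = n.*2.
Proof. by elim: n => //= n ->. Qed.

Lemma weight_alternating_exponents n : weight (alternating_exponents n) = n.*2.
Proof.
elim: n => [|n IH]; first by rewrite /weight big_nil.
by move: IH; rewrite /weight /alternating_exponents /= !big_cons => ->.
Qed.

Definition conjugate_power n (mo : model alpha) (t : R) : R[i] :=
  model_tau mo ((model_sym mo * model_bm mo t * model_sym mo * model_inv mo t) ^+ n).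

(** The guard stands inside the existential so that a polynomial can be chosen for every [n]. *)
Lemma exp_bipoly_conjugate_power n : exists W, (0 < n)%N ->
  exp_bipoly n.*2 (conjugate_power n) W /\
  constant_value W = NC_moment (even_part (symmetry_cumulant alpha)) n.*2.
Proof.
case: n => [|n]; first by exists 0.
have [||W eW cW] := @sym_word_spec R alpha n.+1.*2 1 (-1 :: alternating_exponents n).
- by move=> *; apply: gap_specP.
- by rewrite /= size_alternating_exponents doubleS.
exists W => _; split; last first.
  rewrite cW ?alternates_exponents // NC_moment_even_first_block /= ?size_alternating_exponents //.
  by rewrite odd_double.
have <- : weight (1 :: -1 :: alternating_exponents n) = n.+1.*2.
  exact: weight_alternating_exponents n.+1.
apply: eq_exp_bipoly eW => mo t t0; rewrite /conjugate_power; congr (model_tau mo _).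
rewrite -[_ :: _]/(alternating_exponents n.+1).
elim: n.+1 => [|m IH]; first by rewrite /sym_word big_nil expr0.
rewrite exprS -IH /sym_word /alternating_exponents /= !big_cons /=.
by rewrite !mulrA.
Qed.

End ExpForm.

(** * Passage from probability spaces to free pairs and models *)

Section WstarSpaces.
Variable R : realType.
Implicit Types A B : wstar_probability_space R.

Lemma trace_tracial A : tracial_state (@star R A) (trace A).
Proof. by case: A. Qed.

Lemma star_algebra_gen A (G : set A) x : G x -> star_algebra G x.
Proof. by move=> Gx M [_]; apply. Qed.

Lemma star_algebra_subalgebra A (G : set A) : star_subalgebra (star_algebra G).
Proof.
split=> [M [[]]//|c x y Gx Gy M HM|x y Gx Gy M HM|x Gx M HM].
- have [[_ lin _ _] _] := HM; exact: lin (Gx _ HM) (Gy _ HM).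
- have [[_ _ mul _] _] := HM; exact: mul (Gx _ HM) (Gy _ HM).
- have [[_ _ _ st] _] := HM; exact: st (Gx _ HM).
Qed.

Lemma alternating_nth A (M : bool -> A -> Prop) b s k :
  centered_alternating (trace A) M b s -> (k < size s)%N ->
  M (b (+) odd k) (nth 0 s k) /\ trace A (nth 0 s k) = 0.
Proof.
elim: s b k => [|x s IH] b [|k] //=; first by case=> Mx x0 _ _; rewrite addbF.
by case=> _ _ /IH h /h; rewrite addbN addNb.
Qed.

Lemma star_free2_pair A (G1 G2 : set A) : star_free2 G1 G2 ->
  free_pair (trace A) (fun b => star_algebra (if b then G1 else G2)).
Proof.
move=> fr; split=> [b|b c x y|b x y|b x s alt].
- by have [] := star_algebra_subalgebra (if b then G1 else G2).
- by have [_ lin _ _] := star_algebra_subalgebra (if b then G1 else G2); apply: lin.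
- by have [_ _ mul _] := star_algebra_subalgebra (if b then G1 else G2); apply: mul.
rewrite (big_nth 0) /=; apply: (fr _ (fun k => b (+) odd k)) => k kn.
  exact: (alternating_nth alt).
by rewrite addbN; case: (_ (+) _).
Qed.

Lemma same_star_distribution_moments A B (x : A) (y : B) :
  same_star_distribution x y -> moments (trace A) x =1 moments (trace B) y.
Proof.
move=> xy k; have := xy (nseq k false); rewrite /star_monomial !big_nseq /=.
by rewrite /moments -!Monoid.iteropE /=.
Qed.

(** The cumulants of [- a2] carry the sign [(-1)^n]; by additivity the odd orders cancel and the
    even ones double. *)
Lemma cumulant_difference B (a1 a2 : B) (beta : R) n :
  star_free2 [set a1]%classic [set a2]%classic ->
  (forall k, moments (trace B) a1 k = (symmetry_moment beta k)%:C) ->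
  (forall k, moments (trace B) a2 k = (symmetry_moment beta k)%:C) ->
  (0 < n)%N ->
  cumulant (a1 - a2) n = 2 * (even_part (symmetry_cumulant beta) n)%:C.
Proof.
move=> /star_free2_pair fr m1 m2 n0; have [tau1 _ _] := trace_tracial B.
have M1 : star_algebra (if true then [set a1]%classic else [set a2]%classic) a1.
  exact: star_algebra_gen.
have M2 : star_algebra (if ~~ true then [set a1]%classic else [set a2]%classic) (- a2).
  rewrite -scaleN1r; apply: (free_pair_scale fr (d := false)); exact: star_algebra_gen.
have cum m : m =1 (fun k => (symmetry_moment beta k)%:C) ->
    free_cumulant m n = (symmetry_cumulant beta n)%:C.
  move=> e; rewrite -[RHS](free_cumulant_rmorph (real_complex R)) //.
  by apply: eq_free_cumulant; rewrite ?e.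
rewrite /cumulant (free_cumulantD (b := true) fr tau1 M1 M2) // (cum _ m1).
rewrite (@eq_free_cumulant _ _ (fun k => (-1) ^+ k * moments (trace B) a2 k)) //; last first.
  by move=> k; rewrite /moments -scaleN1r exprZn linearZ.
rewrite free_cumulant_scale ?(cum _ m2) //.
rewrite /even_part -signr_odd; case: odd; rewrite ?mulN1r ?subrr ?rmorph0 ?mulr0 //.
by rewrite mul1r; ring.
Qed.

End WstarSpaces.

Local Open Scope classical_set_scope.
Local Open Scope ring_scope.
Local Open Scope complex_scope.

Section Symmetry.
Variables (R : realType) (A : wstar_probability_space R) (p : A) (theta : R).
Hypothesis p_proj : orthogonal_projection p.
Hypothesis p_trace : trace A p = theta%:C.

Local Notation S := (2 *: p - 1).

Lemma symmetry_sqr : S * S = 1.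
Proof.
have [_ pp] := p_proj.
rewrite mulrBl mul1r mulrBr mulr1 -scalerAl -scalerAr pp scalerA.
have -> : (2 * 2 : R[i]) *: p = 2 *: p + 2 *: p by rewrite -scalerDl; congr (_ *: _); ring.
by rewrite addrK opprB addrC subrK.
Qed.

Lemma symmetry_trace : trace A S = (2 * theta - 1)%:C.
Proof.
have [tau1 _ _] := trace_tracial A.
by rewrite linearB linearZ /= p_trace tau1 rmorphB rmorphM rmorph1 rmorph_nat.
Qed.

Lemma symmetry_moments k : moments (trace A) S k = (symmetry_moment (2 * theta - 1) k)%:C.
Proof.
have [tau1 _ _] := trace_tracial A.
have SX : S ^+ k = if odd k then S else 1.
  by elim: k => [|k IH]; rewrite ?expr0 // exprS IH /=; case: odd; rewrite ?symmetry_sqr ?mulr1.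
by rewrite /moments SX /symmetry_moment; case: odd; rewrite ?symmetry_trace ?tau1 ?rmorph1.
Qed.

(** [b] chooses the sign of the symmetry that has trace [alpha]; the sign disappears because [S]
    occurs twice in each factor. *)
Lemma brownian_model (Y : R -> A) (alpha : R) (b : bool) :
  alpha = (-1) ^+ b * (2 * theta - 1) ->
  free_unitary_brownian_motion Y ->
  star_free2 [set p] [set Y t | t in [set t | 0 <= t]] ->
  exists mo : model alpha, forall n t,
    conjugate_power n mo t = trace A ((S * Y t * S * star (Y t)) ^+ n).
Proof.
move=> alphaE bm /star_free2_pair fr; have [tau1 _ tauC] := trace_tracial A.
pose M (c : bool) := star_algebra
  (if c then [set p] else [set Y t | t in [set t | 0 <= t]]).
pose S' := (-1) ^+ b *: S : A.
have MS : M true S'.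
  apply: (free_pair_scale fr (d := true)); apply: (free_pairB fr (d := true)).
    by apply: (free_pair_scale fr (d := true)); apply: star_algebra_gen.
  exact: (free_pair1 fr true).
have MY t : 0 <= t -> M false (Y t).
  by move=> t0; apply: star_algebra_gen; exists t.
have MYs t : 0 <= t -> M false (star (Y t)).
  move=> t0; have [_ _ _] := star_algebra_subalgebra [set Y t | t in [set t | 0 <= t]].
  by apply; apply: MY.
have SS : S' * S' = 1.
  by rewrite /S' -scalerAl -scalerAr scalerA symmetry_sqr -expr2 sqrr_sign scale1r.
have tauS : trace A S' = alpha%:C.
  rewrite /S' linearZ /= symmetry_trace alphaE rmorphM; congr (_ * _).
  by rewrite rmorph_sign.
have YV t : 0 <= t -> Y t * star (Y t) = 1 by move=> t0; have [] := fubm_unitary bm t0.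
have VY t : 0 <= t -> star (Y t) * Y t = 1 by move=> t0; have [] := fubm_unitary bm t0.
have tauY t k : 0 <= t ->
    trace A (Y t ^+ k) = (expR (- (k%:R / 2 * t)) * (brownian_poly R k).[t])%:C /\
    trace A (star (Y t) ^+ k) = (expR (- (k%:R / 2 * t)) * (brownian_poly R k).[t])%:C.
  move=> t0; case: k => [|k].
    by rewrite !expr0 !mul0r oppr0 expR0 mul1r hornerC tau1 rmorph1.
  have [-> ->] := fubm_moments bm t0 (ltn0Sn k).
  have -> : (k.+1%:R / 2 * t = k.+1%:R * t / 2 :> R) by rewrite mulrAC.
  rewrite -mulrA; suff -> : (brownian_poly R k.+1).[t] =
    k.+1%:R^-1 * (laguerre R 1 k).[k.+1%:R * t] by [].
  by rewrite hornerZ horner_comp hornerZ hornerX.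
pose mo := @Model R alpha A (trace A) M S' Y (fun t => star (Y t)) fr tau1 tauC MS
  MY MYs SS tauS YV VY (fun t k t0 => proj1 (tauY t k t0))
  (fun t k t0 => proj2 (tauY t k t0)).
exists mo => n t; rewrite /conjugate_power /= /S'; congr (trace A (_ ^+ _)).
rewrite -!(scalerAl, scalerAr) scalerA -expr2 sqrr_sign scale1r.
by [].
Qed.

End Symmetry.

Theorem mainTheorem6 (R : realType) :
  exists Pn : nat -> R -> {poly R},
  forall (A : wstar_probability_space R) (p : A) (theta eps : R) (Y : R -> A),
    orthogonal_projection p ->
    trace A p = theta%:C ->
    0 < theta < 1 ->
    let S := 2 *: p - 1 in
    eps%:C = trace A S ^+ 2 ->
    free_unitary_brownian_motion Y ->
    star_free2 [set p] [set Y t | t in [set t | 0 <= t]] ->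
    forall n : nat, (0 < n)%N ->
    let s := fun t : R =>
      (expR (n%:R * t))%:C * trace A ((S * Y t * S * star (Y t)) ^+ n) in
    [/\ (exists Q : nat -> {poly R}, exp_poly_form n s (Pn n eps) Q),
        (forall (P : {poly R}) (Q : nat -> {poly R}),
           exp_poly_form n s P Q -> P = Pn n eps) &
        forall (B : wstar_probability_space R) (a1 a2 : B),
          self_adjoint (@star R B) a1 ->
          self_adjoint (@star R B) a2 ->
          same_star_distribution a1 S ->
          same_star_distribution a2 S ->
          star_free2 [set a1] [set a2] ->
          ((Pn n eps).[0])%:C =
            \sum_(pi in NC (2 * n))
              2^-1 ^+ #|pi| * \prod_(V in pi) cumulant (a1 - a2) #|V|
          /\
          forall mu : {scalar {poly R[i]}},
            free_convolution_power 2^-1 (a1 - a2) mu ->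
            ((Pn n eps).[0])%:C = mu 'X^(2 * n)].
Proof.
pose W n eps := projT1 (cid (exp_bipoly_conjugate_power (Num.sqrt (eps : R)) n)).
have WP n eps : (0 < n)%N ->
    exp_bipoly n.*2 (@conjugate_power R (Num.sqrt eps) n) (W n eps) /\
    constant_value (W n eps) =
      NC_moment (even_part (symmetry_cumulant (Num.sqrt eps))) n.*2.
  exact: (projT2 (cid (exp_bipoly_conjugate_power (Num.sqrt (eps : R)) n))).
exists (fun n eps => (W n eps)`_0) => A p theta eps Y pproj ptau th S epsE bm fr n n0 s.
have [[sW eW] cW] := WP n eps n0.
have alphaE : Num.sqrt eps = (-1) ^+ (2 * theta - 1 < 0)%R * (2 * theta - 1).
  rewrite -normrEsign -sqrtr_sqr; congr Num.sqrt; apply: complexI.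
  by rewrite epsE /S (symmetry_trace ptau) rmorphXn.
have [mo moE] := brownian_model pproj ptau alphaE bm fr.
have form : exp_poly_form n s (W n eps)`_0 (fun k => (W n eps)`_k).
  move=> t t0; rewrite /s -moE; have := eW mo t t0.
  rewrite -muln2 natrM mulfK ?pnatr_eq0 // => ->; congr (_%:C).
  (* The weight [2n] of the word bounds the degree in [e^t] by [n], so the exponentials stop at
     [e^{nt}]. *)
  have sW' : (size (W n eps) <= n.+1)%N by move: sW; lia.
  rewrite (horner_coef_wide _ sW') -(big_mkord xpredT
    (fun i => (W n eps)`_i * (expR t)%:P ^+ i)) big_nat_recl // big_add1 /=.
  rewrite expr0 mulr1 hornerD horner_sum; congr (_ + _).
  apply: eq_bigr => k _.
  by rewrite hornerM -polyC_exp hornerC expRM_natl mulrC.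
split=> [|P Q /exp_poly_form_unique/(_ form)//|B a1 a2 _ _ d1 d2 fr12].
  by exists (fun k => (W n eps)`_k).
have m1 k : moments (trace B) a1 k = (symmetry_moment (2 * theta - 1) k)%:C.
  by rewrite (same_star_distribution_moments d1) (symmetry_moments pproj ptau).
have m2 k : moments (trace B) a2 k = (symmetry_moment (2 * theta - 1) k)%:C.
  by rewrite (same_star_distribution_moments d2) (symmetry_moments pproj ptau).
have half k : (0 < k)%N -> 2^-1 * cumulant (a1 - a2) k =
    (even_part (symmetry_cumulant (Num.sqrt eps)) k)%:C.
  move=> k0; rewrite (cumulant_difference fr12 m1 m2 k0) mulrA mulVf ?mul1r ?pnatr_eq0 //.
  by rewrite alphaE even_part_symmetry_cumulant.
have value : (((W n eps)`_0).[0])%:C =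
    \sum_(pi in NC (2 * n)) \prod_(V in pi) (2^-1 * cumulant (a1 - a2) #|V|).
  rewrite -/(constant_value _) cW -mul2n rmorph_sum; apply: eq_bigr => pi.
  (* Blocks are nonempty, so the comparison of cumulants in positive order suffices; order 0 holds a
     dummy value. *)
  rewrite inE => /andP[/partition_neq0 pi0 _]; rewrite rmorph_prod.
  by apply: eq_bigr => V /pi0; rewrite -card_gt0 => /half->.
split=> [|mu [mu1 muc]].
  rewrite value; apply: eq_bigr => pi _.
  by rewrite big_split /= prodr_const.
have := @moment_cumulant _ (fun j => mu 'X^j) (2 * n); rewrite muln_gt0 n0 => /(_ isT) ->.
rewrite value; apply: eq_bigr => pi; rewrite inE => /andP[/partition_neq0 pi0 _].
apply: eq_bigr => V /pi0; rewrite -card_gt0 => V0.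
by rewrite muc // fmorphV rmorph_nat.
Qed.
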